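(* There exists a first-order sentence $\varphi$ in $\Pi_2$ over the signature $\{E\}$ of graphs such that the property $\{G\in\mathcal{C}_3\mid G\models\varphi\}$ of simple graphs of maximum degree at most $3$ is not testable in the bounded-degree graph model (with degree bound $3$).
   Context: $\mathcal{C}_d$ is the class of finite simple undirected graphs of maximum degree at most $d$, viewed as structures with a symmetric irreflexive binary relation $E$. A property is an isomorphism-closed subset $\mathcal{P}\subseteq\mathcal{C}_d$; $\mathcal{P}_n$ are its $n$-vertex members. A graph $G$ on $n$ vertices is $\epsilon$-far from $\mathcal{P}$ if more than $\epsilon dn$ edge insertions/deletions are needed to turn $G$ into a graph of $\mathcal{P}_n$. An algorithm gets $n$ and oracle access to $G$ (vertices numbered $1,\dots,n$): a query $(v,i)$, $i\le d$, returns the $i$-th neighbour of $v$ or a special symbol if it does not exist. An $\epsilon$-tester for $\mathcal{P}_n$ accepts graphs in $\mathcal{P}_n$ with probability $\ge2/3$ and rejects graphs $\epsilon$-far from $\mathcal{P}_n$ with probability $\ge2/3$; $\mathcal{P}$ is testable if for all $n$ and $\epsilon\in(0,1)$ there is such a tester with at most $q(\epsilon,d)$ queries, independent of $n$. $\Pi_2$ is the set of first-order formulas equivalent to one of the form $\forall x_1\dots\forall x_k\exists y_1\dots\exists y_\ell\,\psi$ with $\psi$ quantifier-free. *)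

(* Defs.v *)
From HB Require Import structures.
From mathcomp Require Import all_boot all_order all_algebra.
From mathcomp Require Import all_classical all_reals all_analysis.

Set Implicit Arguments.
Unset Strict Implicit.
Unset Printing Implicit Defensive.

Import Order.TTheory GRing.Theory Num.Theory.

Local Open Scope classical_set_scope.
Local Open Scope ring_scope.

(* [formula k]: formulas whose free variables are among k de Bruijn indices;
   under a quantifier, index [ord0] is the variable just bound. *)
Inductive formula : nat -> Type :=
  | Edge k (x y : 'I_k) : formula k
  | Equal k (x y : 'I_k) : formula k
  | Neg k (f : formula k) : formula k
  | And k (f g : formula k) : formula k
  | Or k (f g : formula k) : formula k
  | All k (f : formula k.+1) : formula k
  | Ex k (f : formula k.+1) : formula k.

Definition sentence := formula 0.

Definition env_nil (V : Type) (i : 'I_0) : V :=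
  let: Ordinal _ lt_i0 := i in False_rect V (notF lt_i0).

Definition env_cons (V : Type) k (a : V) (e : 'I_k -> V) (i : 'I_k.+1) : V :=
  if unlift ord0 i is Some j then e j else a.

Fixpoint sat (V : Type) (E : V -> V -> Prop) k (f : formula k) :
    ('I_k -> V) -> Prop :=
  match f in formula k return ('I_k -> V) -> Prop with
  | Edge _ x y => fun e => E (e x) (e y)
  | Equal _ x y => fun e => e x = e y
  | Neg _ f => fun e => ~ sat E f e
  | And _ f g => fun e => sat E f e /\ sat E g e
  | Or _ f g => fun e => sat E f e \/ sat E g e
  | All _ f => fun e => forall a, sat E f (env_cons a e)
  | Ex _ f => fun e => exists a, sat E f (env_cons a e)
  end.

Definition models (V : Type) (E : V -> V -> Prop) (phi : sentence) : Prop :=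
  sat E phi (@env_nil V).

Fixpoint quantifier_free k (f : formula k) : bool :=
  match f with
  | Edge _ _ _ | Equal _ _ _ => true
  | Neg _ f => quantifier_free f
  | And _ f g | Or _ f g => quantifier_free f && quantifier_free g
  | All _ _ | Ex _ _ => false
  end.

Fixpoint forall_block k : formula k -> sentence :=
  match k return formula k -> sentence with
  | 0 => fun f => f
  | k'.+1 => fun f => forall_block (All f)
  end.

Fixpoint exists_block l k : formula (l + k) -> formula k :=
  match l return formula (l + k) -> formula k with
  | 0 => fun f => f
  | l'.+1 => fun f => @exists_block l' k (Ex f)
  end.

(* Logical equivalence is over all {E}-structures, finite or not. *)
Definition equivalent (phi psi : sentence) : Prop :=
  forall (V : Type) (E : V -> V -> Prop), models E phi <-> models E psi.

Definition Pi2 (phi : sentence) : Prop :=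
  exists (k l : nat) (psi : formula (l + k)),
    quantifier_free psi /\
    equivalent phi (forall_block (@exists_block l k psi)).

Record graph (n : nat) := Graph {
  adj :> rel 'I_n;
  adj_sym : symmetric adj;
  adj_irr : irreflexive adj }.

Definition degree n (G : graph n) (v : 'I_n) : nat := #|[set w | G v w]%SET|.

Definition bounded_degree (d : nat) n (G : graph n) : Prop :=
  forall v, (degree G v <= d)%N.

Definition isomorphic n (G H : graph n) : Prop :=
  exists2 f : 'I_n -> 'I_n, bijective f & forall u v, H (f u) (f v) = G u v.

Record property (d : nat) := Property {
  holds :> forall n, graph n -> Prop;
  holds_bounded : forall n (G : graph n), holds G -> bounded_degree d G;
  holds_iso : forall n (G H : graph n), isomorphic G H -> holds G -> holds H }.

Lemma sat_iso (V W : Type) (E : V -> V -> Prop) (F : W -> W -> Prop)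
    (h : V -> W) : bijective h -> (forall u v, F (h u) (h v) <-> E u v) ->
  forall k (f : formula k) (e : 'I_k -> V) (e' : 'I_k -> W),
  (forall i, e' i = h (e i)) -> sat E f e <-> sat F f e'.
Proof.
move=> bij_h hE k f; have inj_h := bij_inj bij_h; have [h' hK h'K] := bij_h.
have ext m (e : 'I_m -> V) (e' : 'I_m -> W) a : (forall i, e' i = h (e i)) ->
  forall i, env_cons (h a) e' i = h (env_cons a e i).
  by move=> ee' i; rewrite /env_cons; case: unlift.
elim: f => {k} [k x y|k x y|k f IHf|k f IHf g IHg|k f IHf g IHg|k f IHf
  |k f IHf] e e' ee' /=.
- by rewrite !ee'; apply: iff_sym.
- by rewrite !ee'; split=> [->|/inj_h].
- by have := IHf _ _ ee'; tauto.
- by have := IHf _ _ ee'; have := IHg _ _ ee'; tauto.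
- by have := IHf _ _ ee'; have := IHg _ _ ee'; tauto.
- split=> sf a; last by apply/(IHf _ _ (ext _ _ _ a ee')).
  by rewrite -(h'K a); apply/(IHf _ _ (ext _ _ _ (h' a) ee')).
- split=> -[a sf]; first by exists (h a); apply/(IHf _ _ (ext _ _ _ a ee')).
  by exists (h' a); apply/(IHf _ _ (ext _ _ _ (h' a) ee')); rewrite h'K.
Qed.

Definition graph_models n (G : graph n) (phi : sentence) : Prop :=
  models (fun u v : 'I_n => G u v) phi.

Lemma isomorphic_degree n (G H : graph n) d :
  isomorphic G H -> bounded_degree d G -> bounded_degree d H.
Proof.
move=> [f bij_f fE] dG v; have inj_f := bij_inj bij_f.
have [f' fK f'K] := bij_f; rewrite -(f'K v).
apply: leq_trans (dG (f' v)); rewrite /degree.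
rewrite -[leqRHS](card_imset _ inj_f) subset_leq_card //.
apply/fintype.subsetP => w; rewrite inE f'K => Hvw.
by apply/imsetP; exists (f' w); rewrite ?f'K // inE -fE !f'K.
Qed.

Lemma isomorphic_models n (G H : graph n) phi :
  isomorphic G H -> graph_models G phi -> graph_models H phi.
Proof.
move=> [f bij_f fE] Gphi.
have EF u v : H (f u) (f v) <-> G u v by rewrite fE.
have e0 (i : 'I_0) : env_nil 'I_n i = f (env_nil 'I_n i) by case: i.
exact: (proj1 (@sat_iso _ _ (fun u v => G u v) (fun u v => H u v)
  f bij_f EF 0 phi _ _ e0) Gphi).
Qed.

Program Definition fo_property (d : nat) (phi : sentence) : property d :=
  @Property d (fun n G => bounded_degree d G /\ graph_models G phi) _ _.
Next Obligation. by move=> d phi n G []. Qed.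
Next Obligation.
move=> d phi n G H GH [dG Gphi].
by split; [apply: isomorphic_degree GH dG | apply: isomorphic_models GH Gphi].
Qed.

Definition edges n (G : graph n) : {set {set 'I_n}} :=
  [set [set p.1; p.2] | p : 'I_n * 'I_n & G p.1 p.2]%SET.

(* Deletions plus insertions needed to turn G into H. *)
Definition edit_distance n (G H : graph n) : nat :=
  (#|edges G :\: edges H| + #|edges H :\: edges G|)%N.

(* If no n-vertex graph has the property, every G is far from it. *)
Definition far (R : realType) (eps : R) d (P : property d) n (G : graph n) :
    Prop :=
  forall H : graph n, P n H -> eps * d%:R * n%:R < (edit_distance G H)%:R.

(* Vertices and neighbour positions are numbered from 0; [None] is the answer
   to a query for a neighbour that does not exist. *)
Definition oracle (n d : nat) := 'I_n -> 'I_d -> option 'I_n.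

(* The neighbours of a vertex may be listed in any order. *)
Definition oracle_of n d (G : graph n) (g : oracle n d) : Prop :=
  forall v, exists s : seq 'I_n,
    [/\ uniq s, forall w, (w \in s) = G v w
      & forall i : 'I_d, g v i = onth s i].

(* Deterministic adaptive algorithms, for fixed n and d. *)
Inductive decision_tree (n d : nat) :=
  | Answer (accept : bool)
  | Query (v : 'I_n) (i : 'I_d) (next : option 'I_n -> decision_tree n d).

Fixpoint accepts n d (g : oracle n d) (t : decision_tree n d) : bool :=
  match t with
  | Answer b => b
  | Query v i next => accepts g (next (g v i))
  end.

Fixpoint num_queries n d (g : oracle n d) (t : decision_tree n d) : nat :=
  match t with
  | Answer _ => 0
  | Query v i next => (num_queries g (next (g v i))).+1
  end.

(* A randomized algorithm is a deterministic one depending on a random seed,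
   drawn from an arbitrary probability space. *)
Record algorithm (R : realType) (n d : nat) := Algorithm {
  seed_display : measure_display;
  seed : measurableType seed_display;
  seed_law : probability seed R;
  decide : seed -> decision_tree n d;
  measurable_decide :
    forall g : oracle n d, measurable [set w | accepts g (decide w)] }.

Definition pr_accept (R : realType) n d (A : algorithm R n d)
    (g : oracle n d) : \bar R :=
  seed_law A [set w | accepts g (decide w)].

Definition pr_reject (R : realType) n d (A : algorithm R n d)
    (g : oracle n d) : \bar R :=
  seed_law A [set w | ~~ accepts g (decide w)].

Definition tester (R : realType) (eps : R) d (P : property d) n
    (A : algorithm R n d) : Prop :=
  forall (G : graph n) (g : oracle n d),
    bounded_degree d G -> oracle_of G g ->
    (P n G -> ((2 / 3)%:E <= pr_accept A g)%E) /\
    (far eps P G -> ((2 / 3)%:E <= pr_reject A g)%E).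

Definition query_bound (R : realType) n d (A : algorithm R n d) (q : nat) :
    Prop :=
  forall (G : graph n) (g : oracle n d) (w : seed A),
    bounded_degree d G -> oracle_of G g -> (num_queries g (decide w) <= q)%N.

Definition testable (R : realType) d (P : property d) : Prop :=
  exists q : R -> nat, forall (n : nat) (eps : R), 0 < eps < 1 ->
    exists2 A : algorithm R n d, tester eps P A & query_bound A (q eps).

(* Main.v *)
Require Import Defs.
From mathcomp Require Import all_boot all_order all_algebra.
From mathcomp Require Import all_classical all_reals all_analysis.
From mathcomp Require Import measurable_realfun fingroup perm zify ring lra.

(** The sentence describes a tower of graphs.  Level [j] consists of the words of
    length [j] over the four letters of [F_2^2], seen as vectors of polynomials
    truncated at degree [j]; a word [l :: u] is a child of [u], and two
    permutations act on every level: [map rot3], of order 3 on each letter, and the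
    affine involution [twist], adding to one coordinate [t] times the other plus 1.
    Both are given by finite automata, so their action on a word is determined
    locally by their action on its parent.  Replacing every word by a rigid
    gadget gives a cubic graph [G_k] on the words of length at most [k].

    The sentence says that the graph looks locally like some [G_k] and has at most
    one root.  In a finite model the leaves must all be on the same level, and
    following parents must end in the root (a cycle of parents would generate
    an infinite tree), so the finite models are exactly the [G_k].

    The bottom level of [G_k] is an expander.  In Walsh coordinates an almost
    invariant function gives a measure on dual words, classified by their first
    nonzero letter.  The rotation permutes the three classes, while the twist
    sends two of them into the third, so each class has almost no mass.

    Dropping the last letter makes [G_(k+1)], away from its root, a 4-fold cover of
    [G_k].  The density of vertices where two given walks of bounded length meet
    decreases along the tower, hence converges, so for suitable [k] almost all
    vertices of [G_(k+1)] have the same neighbourhoods as in four disjoint copies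
    of [G_k].  The latter graph is far from [G_(k+1)] because of expansion, but a
    tester with boundedly many queries cannot tell them apart after a random
    relabelling. *)

Set Implicit Arguments.
Unset Strict Implicit.
Unset Printing Implicit Defensive.

Import Order.TTheory GRing.Theory Num.Theory.

(** * Words and the matching of darts *)

Definition letter := (bool * bool)%type.
Definition word := seq letter.

Definition rot3 (l : letter) : letter := (l.2, l.1 (+) l.2).
Definition rot3i (l : letter) : letter := (l.1 (+) l.2, l.1).
Definition opp (l : letter) : letter := (~~ l.1, l.2).

Lemma rot3K : cancel rot3 rot3i. Proof. by case=> [] [] []. Qed.
Lemma rot3iK : cancel rot3i rot3. Proof. by case=> [] [] []. Qed.
Lemma oppK : involutive opp. Proof. by case=> [] [] []. Qed.
Lemma opp_neq l : opp l != l. Proof. by case: l => [] [] []. Qed.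

Definition flip (w : word) : word := if w is l :: u then opp l :: u else [::].

(** The head is the constant coefficient. The recursive call already adds 1 to the next letter, so
    the extra [flip] when [l.2] is 0 leaves a net change of [l.2]: the first coordinate of each
    later letter gains the second coordinate of its predecessor, and only the head gains 1. *)
Fixpoint twist (w : word) : word :=
  if w is l :: u then opp l :: (if l.2 then twist u else flip (twist u))
  else [::].

Lemma flipK : involutive flip.
Proof. by case=> //= l u; rewrite oppK. Qed.

Lemma size_flip w : size (flip w) = size w. Proof. by case: w. Qed.

Lemma size_twist w : size (twist w) = size w.
Proof. by elim: w => //= l u; case: ifP => _; rewrite ?size_flip => ->. Qed.

Lemma twist_flip w : twist (flip w) = flip (twist w).
Proof. by case: w => [|[a b] u]. Qed.

Lemma twistK : involutive twist.
Proof.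
elim=> [|[a b] u IHu] //=; case: b; rewrite /opp /= negbK.
  by rewrite IHu.
by rewrite twist_flip IHu flipK.
Qed.

Definition dart := (letter + letter)%type.
Notation Rp := (inl (false, false) : dart).
Notation Rm := (inl (false, true) : dart).
Notation Tw := (inl (true, false) : dart).
Notation Par := (inl (true, true) : dart).
Notation Ch := (inr : letter -> dart).

(* The external edges of the level-[k] graph, as a matching of darts: [Rp]/[Rm]
   are the two ends of a rotation edge, [Tw] of a twist edge, [Par]/[Ch l] of a
   tree edge.  At the root [Tw] and [Par] are joined together, and so are the
   child darts of a leaf, which makes the matching perfect. *)
Definition mu (k : nat) (x : word * dart) : word * dart :=
  let: (w, d) := x in
  match d with
  | inl (false, false) => (map rot3 w, Rm)
  | inl (false, true) => (map rot3i w, Rp)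
  | inl (true, false) => if w is [::] then ([::], Par) else (twist w, Tw)
  | inl (true, true) => if w is l :: u then (u, Ch l) else ([::], Tw)
  | inr l => if size w < k then (l :: w, Par) else (w, Ch (opp l))
  end.

Lemma size_mu k x : size x.1 <= k -> size (mu k x).1 <= k.
Proof.
case: x => w [[[] []]|l] /=; rewrite ?size_map //.
- by case: w => //= l u; lia.
- by case: w => //= l u; case: ifP => _; rewrite ?size_flip size_twist.
- by case: ifP.
Qed.

Lemma muK k x : size x.1 <= k -> mu k (mu k x) = x.
Proof.
case: x => w [[[] []]|l] /=.
- by case: w => //= l u ->.
- case: w => // l u _; rewrite -[in RHS](twistK (l :: u)).
  by case: (twist (l :: u)) (size_twist (l :: u)).
- by move=> _; rewrite -map_comp (eq_map rot3iK) map_id.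
- by move=> _; rewrite -map_comp (eq_map rot3K) map_id.
- by case: ltnP => //= h1 h2; rewrite ltnNge h1 /= oppK.
Qed.

Lemma twist_neq l u : twist (l :: u) != l :: u.
Proof. by rewrite /= eqseq_cons negb_and opp_neq. Qed.

Lemma mu_neq k x : mu k x != x.
Proof.
case: x => w [[[] []]|l] //=; rewrite ?xpair_eqE ?andbF //.
- by case: w => [|l u] //=; rewrite xpair_eqE andbF.
- by case: w => [|l u] //; rewrite xpair_eqE negb_and twist_neq.
- by case: ifP; rewrite xpair_eqE ?andbF // eqxx /= (inj_eq inr_inj) opp_neq.
Qed.

Section Walks.
Variables (X : Type) (m : X * dart -> X * dart).

Fixpoint walk (c : X) (u : seq dart) : X :=
  if u is d :: u' then walk (m (c, d)).1 u' else c.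

End Walks.

Lemma size_walk k w u : size w <= k -> size (walk (mu k) w u) <= k.
Proof. by elim: u w => //= d u IHu w sw; apply: IHu; apply: (size_mu (x := (w, d))). Qed.

(** * The gadget *)

(* The gadget replacing a vertex: the prism over a 10-cycle (outer vertices
   [0..9], inner vertices [10..19]) with eight of its cycle edges subdivided by
   the ports [20..27].  Each of its edges lies on a cycle of length 4 or 5, and
   ports to be joined by an external edge are at distance at least 5. *)
Definition nb_table : seq (seq nat) :=
  [:: [:: 1; 9; 10]; [:: 0; 11; 25]; [:: 12; 22; 25]; [:: 13; 22; 26];
      [:: 14; 26; 27]; [:: 15; 20; 27]; [:: 7; 16; 20]; [:: 6; 8; 17];
      [:: 7; 9; 18]; [:: 0; 8; 19]; [:: 0; 21; 24]; [:: 1; 12; 24];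
      [:: 2; 11; 13]; [:: 3; 12; 14]; [:: 4; 13; 15]; [:: 5; 14; 16];
      [:: 6; 15; 17]; [:: 7; 16; 23]; [:: 8; 19; 23]; [:: 9; 18; 21];
      [:: 5; 6]; [:: 10; 19]; [:: 2; 3]; [:: 17; 18]; [:: 10; 11]; [:: 1; 2];
      [:: 3; 4]; [:: 4; 5]].

Definition nb (s : nat) : seq nat := nth [::] nb_table s.

Notation pos := 'I_28.

Lemma all_pos (P : pred nat) : all P (iota 0 28) -> forall s : pos, P s.
Proof. by move/allP => h s; apply: h; rewrite mem_iota /=. Qed.

Lemma nb_lt (s : nat) t : t \in nb s -> t < 28.
Proof.
case: (ltnP s 28) => [s28|?]; last by rewrite /nb nth_default.
have /allP h : all (fun s => all (fun t => t < 28) (nb s)) (iota 0 28) by [].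
by have := h s; rewrite mem_iota => /(_ s28)/allP; apply.
Qed.

Lemma nb_sym (s t : pos) : (val t \in nb s) = (val s \in nb t).
Proof.
have /all_pos/(_ s)/all_pos/(_ t)/eqP // : all (fun s => all (fun t =>
  (t \in nb s) == (s \in nb t)) (iota 0 28)) (iota 0 28) by vm_compute.
Qed.

Lemma nb_irr (s : pos) : (val s \in nb s) = false.
Proof. by apply/negbTE; exact: (@all_pos (fun s => s \notin nb s)). Qed.

Lemma nb_uniq (s : pos) : uniq (nb s).
Proof. exact: (@all_pos (fun s => uniq (nb s))). Qed.

Lemma size_nb (s : pos) : size (nb s) = if 20 <= s then 2 else 3.
Proof.
by apply/eqP; exact: (@all_pos (fun s => size (nb s) == if 20 <= s then 2 else 3)).
Qed.

Lemma nb_port (s : pos) t : 20 <= s -> t \in nb s -> t < 20.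
Proof.
move=> s20; have /all_pos/(_ s) : all (fun s => (20 <= s) ==>
  all (fun t => t < 20) (nb s)) (iota 0 28) by [].
by rewrite s20 => /allP h /h.
Qed.

Fixpoint nb_ball (n : nat) : seq nat :=
  if n is n'.+1 then undup (nb_ball n' ++ flatten (map nb (nb_ball n')))
  else [:: 0].

(** Ten rounds of neighbours starting from position 0 cover all 28 positions. *)
Lemma gadget_connected (P : pos -> Prop) (s0 : pos) :
  (forall s t : pos, val t \in nb s -> P s -> P t) -> P s0 -> forall s, P s.
Proof.
move=> step Ps0.
have ball0 n (Q : pos -> Prop) : (forall s t : pos, val t \in nb s -> Q s -> Q t) ->
    Q ord0 -> forall t : pos, val t \in nb_ball n -> Q t.
  move=> stepQ Q0; elim: n => [|n IHn] t /=.
    by rewrite inE => /eqP e; rewrite (_ : t = ord0) //; apply: val_inj.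
  rewrite mem_undup mem_cat => /orP[/IHn //|/flattenP[_ /mapP[s sn ->] ts]].
  have s28 : s < 28.
    by case: (ltnP s 28) ts => // s28; rewrite /nb nth_default.
  exact: (stepQ (Ordinal s28)) ts (IHn (Ordinal s28) sn).
have all10 : forall t : pos, val t \in nb_ball 10.
  by apply: (@all_pos (fun t => t \in nb_ball 10)); vm_compute.
have P0 : P ord0.
  (* The walk from 0 to [s0] is read backwards: what propagates is the implication towards [P ord0],
     and symmetry of the edges reverses each step. *)
  apply: (ball0 10 (fun s => P s -> P ord0)) (all10 s0) Ps0 => // s t ts h Pt.
  by apply: h; apply: step Pt; rewrite -nb_sym.
by move=> s; apply: (ball0 10) (all10 s).
Qed.

(** Every entry after the first is adjacent to an earlier one, so each extension in the search below
    has at most three candidate images. *)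
Definition gadget_order : seq nat :=
  [:: 0; 1; 9; 8; 7; 6; 10; 11; 24; 12; 2; 25; 13; 3; 22; 14; 4; 26; 15; 16;
      17; 5; 20; 27; 18; 19; 21; 23].

Definition extend_homs (done : seq nat) (hs : seq (seq nat)) (x : nat) :=
  flatten [seq [seq rcons h v | v <- iota 0 28 & (v \notin h) &&
      all (fun p => (x \in nb p.1) ==> (v \in nb p.2)) (zip done h)] | h <- hs].

(* All injective homomorphisms into the gadget from its part [done], tabulated
   by the list of images, extended along [todo]. *)
Fixpoint gadget_homs (done : seq nat) (hs : seq (seq nat)) (todo : seq nat) :=
  if todo is x :: todo' then
    gadget_homs (rcons done x) (extend_homs done hs x) todo'
  else hs.

(** Exhaustive search: the table of images of an injective homomorphism survives every extension
    ([sound]), and the computed list of survivors contains only the identity table. *)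
Lemma gadget_rigid (h : pos -> pos) : injective h ->
  (forall s t : pos, val t \in nb s -> val (h t) \in nb (h s)) -> h =1 id.
Proof.
move=> hi hh; pose g s := val (h (inord s)).
have gi s t : s < 28 -> t < 28 -> g s = g t -> s = t.
  move=> s28 t28 /val_inj/hi e.
  by have := congr1 val e; rewrite /= !inordK.
have gh s t : s < 28 -> t \in nb s -> g t \in nb (g s).
  by move=> s28 ts; have t28 := nb_lt ts; apply: hh; rewrite /= !inordK.
have sound done hs todo : uniq (done ++ todo) ->
    (forall s, s \in done ++ todo -> s < 28) -> map g done \in hs ->
    map g (done ++ todo) \in gadget_homs done hs todo.
  elim: todo done hs => [|x todo IH] done hs /=; first by rewrite cats0.
  rewrite -cat_rcons => un lt dh; apply: IH => //.
  have xd : x \notin done.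
    by move: un; rewrite cat_uniq rcons_uniq => /andP[/andP[]].
  have lt' s : s \in rcons done x -> s < 28.
    by move=> sd; apply: lt; rewrite mem_cat sd.
  apply/flattenP; eexists; first by apply/mapP; exists (map g done).
  rewrite map_rcons; apply/mapP; exists (g x) => //.
  rewrite mem_filter mem_iota leq0n ltn_ord !andbT; apply/andP; split.
    apply/negP => /mapP[y yd e]; move: xd; rewrite (gi _ _ _ _ e) ?yd //.
      by apply: lt'; rewrite mem_rcons mem_head.
    by apply: lt'; rewrite mem_rcons inE yd orbT.
  have {}lt' s : s \in done -> s < 28.
    by move=> sd; apply: lt'; rewrite mem_rcons inE sd orbT.
  apply/allP => -[y v] /=; rewrite -[X in zip X _]map_id zip_map.
  by case/mapP=> z zd [-> ->]; apply/implyP; apply: gh; apply: lt'.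
have perm_o : perm_eq gadget_order (iota 0 28) by vm_compute.
have := sound [::] [:: [::]] gadget_order.
rewrite (perm_uniq perm_o) iota_uniq => /(_ isT) /(_ _ (mem_head _ _)).
have -> : gadget_homs [::] [:: [::]] gadget_order = [:: gadget_order] by vm_compute.
move=> /(_ _) H s; apply/val_inj.
have so : val s \in gadget_order by rewrite (perm_mem perm_o) mem_iota /=.
have {}H : map g gadget_order = gadget_order.
  apply/eqP; move: H; rewrite inE; apply=> t.
  by rewrite (perm_mem perm_o) mem_iota.
have : nth 0 (map g gadget_order) (index (val s) gadget_order) = val s.
  by rewrite H nth_index.
by rewrite (nth_map 0) ?index_mem // nth_index // /g inord_val.
Qed.

Definition port_list : seq dart :=
  [:: Rp; Rm; Tw; Par; Ch (false, false); Ch (false, true); Ch (true, false);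
      Ch (true, true)].

Lemma index_port_lt d : 20 + index d port_list < 28.
Proof. by case: d => [[[] []]|[[] []]]. Qed.

Definition port_pos (d : dart) : pos := Ordinal (index_port_lt d).
Arguments port_pos : simpl never.
Definition port (s : nat) : dart := nth Par port_list (s - 20).

Lemma port_posK d : port (port_pos d) = d.
Proof. by case: d => [[[] []]|[[] []]]. Qed.

Lemma portK (s : pos) : 20 <= s -> port_pos (port s) = s.
Proof.
move=> s20; apply/val_inj/eqP.
have /all_pos/(_ s) : all (fun s => (20 <= s) ==>
  (val (port_pos (port s)) == s)) (iota 0 28) by vm_compute.
by rewrite s20.
Qed.

Lemma port_pos_ge d : 20 <= port_pos d. Proof. exact: leq_addr. Qed.

(** * The level graphs *)

Definition vertex := (word * pos)%type.

Section Graph.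
Variable k : nat.

Definition ext (x : vertex) : vertex :=
  let y := mu k (x.1, port x.2) in (y.1, port_pos y.2).

Definition nbrs (x : vertex) : seq vertex :=
  [seq (x.1, inord s) | s <- nb x.2] ++ (if 20 <= x.2 then [:: ext x] else [::]).

Definition internal (x y : vertex) := (x.1 == y.1) && (val y.2 \in nb x.2).
Definition external (x y : vertex) := (20 <= x.2) && (y == ext x).

Lemma mem_nbrs (x y : vertex) : (y \in nbrs x) = internal x y || external x y.
Proof.
rewrite mem_cat; congr orb; last by rewrite /external; case: ifP => _; rewrite ?inE.
apply/mapP/andP => [[s sx ->]|[/eqP e yx]].
  by have s28 := nb_lt sx; rewrite /= inordK ?sx.
by exists (val y.2) => //; case: y e yx => w t /= -> _; rewrite inord_val.
Qed.

Lemma size_nbrs (x : vertex) : size (nbrs x) = 3.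
Proof. by rewrite size_cat size_map size_nb; case: ifP. Qed.

Lemma ext_ge (x : vertex) : 20 <= (ext x).2. Proof. exact: port_pos_ge. Qed.

Lemma extK (x : vertex) : size x.1 <= k -> 20 <= x.2 -> ext (ext x) = x.
Proof.
move=> sx x20; have := muK (x := (x.1, port x.2)) sx; rewrite /ext.
case: (mu k (x.1, _)) => w d; rewrite port_posK => -> /=.
by rewrite portK //; case: x {sx x20}.
Qed.

Lemma size_ext (x : vertex) : size x.1 <= k -> size (ext x).1 <= k.
Proof. by move=> sx; apply: (size_mu (x := (x.1, port x.2))). Qed.

Lemma ext_neq (x : vertex) : 20 <= x.2 -> ext x != x.
Proof.
move=> x20; apply: contraNneq (mu_neq k (x.1, port x.2)) => e.
move: e; rewrite /ext; case: (mu k (x.1, _)) => w d /= e.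
by rewrite -e /= port_posK.
Qed.

Lemma internal_sym (x y : vertex) : internal x y = internal y x.
Proof. by rewrite /internal eq_sym nb_sym. Qed.

Lemma nbrs_uniq (x : vertex) : uniq (nbrs x).
Proof.
rewrite cat_uniq map_inj_in_uniq ?nb_uniq /=; last first.
  move=> s t sx tx [] /(congr1 val) /=.
  by have s28 := nb_lt sx; have t28 := nb_lt tx; rewrite !inordK.
case: ifP => //= x20; rewrite orbF andbT; apply/mapP => -[s sx].
move=> /(congr1 (fun y => val y.2)) /= e.
have := ext_ge x; rewrite /= e inordK ?(nb_lt sx) //.
by rewrite leqNgt (nb_port _ sx).
Qed.

Lemma nbrs_irr (x : vertex) : x \notin nbrs x.
Proof.
rewrite mem_nbrs negb_or /internal nb_irr andbF /=.
by apply/negP => /andP[x20 /eqP e]; have := ext_neq x20; rewrite -e eqxx.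
Qed.

Lemma size_of_nbrs (x y : vertex) : size x.1 <= k -> y \in nbrs x -> size y.1 <= k.
Proof.
move=> sx; rewrite mem_nbrs => /orP[/andP[/eqP <-] //|/andP[_ /eqP ->]].
exact: size_ext.
Qed.

Lemma nbrs_sym (x y : vertex) : size x.1 <= k -> y \in nbrs x -> x \in nbrs y.
Proof.
move=> sx; rewrite !mem_nbrs => /orP[|/andP[x20 /eqP ->]].
  by rewrite internal_sym => ->.
by rewrite /external ext_ge extK // eqxx orbT.
Qed.

End Graph.

(** * External edges lie on no cycle of length 4 or 5 *)

Definition ext_types (s : nat) : seq nat :=
  if s < 20 then [::] else
  map (fun d => val (port_pos d))
    (match port s with
     | inl (false, false) => [:: Rm]
     | inl (false, true) => [:: Rp]
     | inl (true, false) => [:: Tw; Par]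
     | inl (true, true) => [:: Tw; Ch (false, false); Ch (false, true);
                              Ch (true, false); Ch (true, true)]
     | inr l => [:: Par; Ch (opp l)]
     end).

(* Steps of non-backtracking walks, recording only whether the last edge is
   external and the positions of its end points. *)
Definition type_steps (st : bool * nat * nat) : seq (bool * nat * nat) :=
  let: (e, p, c) := st in
  [seq (false, c, t) | t <- nb c & e || (t != p)] ++
  (if e then [::] else [seq (true, c, t) | t <- ext_types c]).

Fixpoint type_walks n (sts : seq (bool * nat * nat)) :=
  if n is n'.+1 then type_walks n' (flatten (map type_steps sts)) else sts.

(** After a first external edge leaving [s0], [n] further steps may end at type [s0] only through an
    external edge. In a closed walk that edge is the first one retraced, because external edges form
    a matching. *)
Definition no_return n := all (fun s0 => all (fun s1 =>
  all (fun st => st.1.1 || (st.2 != s0)) (type_walks n [:: (true, s0, s1)]))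
  (ext_types s0)) (iota 0 28).

Definition on_short_cycle s t :=
  has (fun a => (a != s) && has (fun b => (b != t) &&
    ((s \in nb b) || (b != s) &&
     has (fun c => [&& c != a, c != t & s \in nb c]) (nb b))) (nb a)) (nb t).

Section Copies.
Variable k : nat.

Definition joined (e : bool) (x y : vertex) :=
  if e then external k x y else internal x y.

Lemma ext_typesP (x : vertex) : 20 <= x.2 -> val (ext k x).2 \in ext_types x.2.
Proof.
move=> x20; rewrite /ext_types ltnNge x20 /=; apply: map_f.
case: x => w s /= in x20 *; move: (port s) => [[[] []]|[[] []]] //=.
- by case: w => //= -[[] []] u.
- by case: w.
all: by case: ifP.
Qed.

(** Types are sound for real walks: after an external edge another external step would go back, by
    [extK], and after an internal edge only the previous position is excluded. *)
Lemma type_step e x y z : size x.1 <= k -> joined e x y -> z \in nbrs k y ->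
  z != x -> exists2 e', joined e' y z &
    (e', val y.2, val z.2) \in type_steps (e, val x.2, val y.2).
Proof.
move=> sx xy; rewrite mem_nbrs => /orP[yz|yz] zx.
  exists false => //; rewrite mem_cat; apply/orP; left; apply: map_f.
  case/andP: yz => /eqP yz zy; rewrite mem_filter zy andbT.
  case: e xy => //= /andP[/eqP xy _]; apply: contraNneq zx => e2.
  by apply/eqP; rewrite [z]surjective_pairing [x]surjective_pairing -yz -xy;
     congr pair; apply: val_inj.
exists true => //; rewrite mem_cat; apply/orP; right.
case: e xy => /= [/andP[x20 /eqP yE]|_].
  by move: zx; case/andP: yz => _; rewrite yE extK // => ->.
by apply: map_f; case/andP: yz => y20 /eqP ->; apply: ext_typesP.
Qed.

Lemma type_walks_step st st' : st' \in type_steps st ->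
  forall n P, all P (type_walks n.+1 [:: st]) -> all P (type_walks n [:: st']).
Proof.
move=> h2 n P /=; rewrite cats0.
have sub m a b : {subset a <= b} -> {subset type_walks m a <= type_walks m b}.
  elim: m a b => //= m IHm a b ab; apply: IHm => x /flattenP[_ /mapP[y ya ->] xy].
  by apply/flattenP; exists (type_steps y) => //; apply/map_f/ab.
move=> /allP h; apply/allP => x xn; apply: h; apply: sub xn => y.
by rewrite inE => /eqP ->.
Qed.

Lemma no_returnP n x0 x1 : no_return n -> external k x0 x1 ->
  all (fun st => st.1.1 || (st.2 != val x0.2))
    (type_walks n [:: (true, val x0.2, val x1.2)]).
Proof.
move=> /all_pos/(_ x0.2)/allP h /andP[x20 /eqP e]; apply: h.
by rewrite e; apply: ext_typesP.
Qed.

(** By [no_return 3] the cycle would have to close through an external edge at [x0]. The matching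
    then makes [x3] equal to [x1]. *)
Lemma no_ext_4cycle x0 x1 x2 x3 : size x0.1 <= k -> external k x0 x1 ->
  x2 \in nbrs k x1 -> x3 \in nbrs k x2 -> x0 \in nbrs k x3 ->
  x2 != x0 -> x3 != x1 -> False.
Proof.
move=> s0 e01 n12 n23 n30 d20 d31.
have s1 : size x1.1 <= k by apply: (size_of_nbrs s0); rewrite mem_nbrs e01 orbT.
have s2 := size_of_nbrs s1 n12; have s3 := size_of_nbrs s2 n23.
have nr : no_return 3 by vm_compute.
have := no_returnP nr e01.
have [f12 e12 /type_walks_step h] := type_step (e := true) s0 e01 n12 d20.
move=> /(h 2) {h}.
have [f23 e23 /type_walks_step h] := type_step s1 e12 n23 d31.
move=> /(h 1) {h}.
rewrite eq_sym in d20.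
have [f30 e30 /type_walks_step h] := type_step s2 e23 n30 d20.
move=> /(h 0) /=.
rewrite eqxx orbF andbT => f30E; move: e30; rewrite f30E => /andP[p3 /eqP e].
by move: d31; case/andP: e01 => _ /eqP ->; rewrite e extK // eqxx.
Qed.

Lemma no_ext_5cycle x0 x1 x2 x3 x4 : size x0.1 <= k -> external k x0 x1 ->
  x2 \in nbrs k x1 -> x3 \in nbrs k x2 -> x4 \in nbrs k x3 ->
  x0 \in nbrs k x4 ->
  x2 != x0 -> x3 != x1 -> x4 != x2 -> x3 != x0 -> x4 != x1 -> False.
Proof.
move=> s0 e01 n12 n23 n34 n40 d20 d31 d42 d30 d41.
have s1 : size x1.1 <= k by apply: (size_of_nbrs s0); rewrite mem_nbrs e01 orbT.
have s2 := size_of_nbrs s1 n12; have s3 := size_of_nbrs s2 n23.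
have s4 := size_of_nbrs s3 n34.
have nr : no_return 4 by vm_compute.
have := no_returnP nr e01.
have [f12 e12 /type_walks_step h] := type_step (e := true) s0 e01 n12 d20.
move=> /(h 3) {h}.
have [f23 e23 /type_walks_step h] := type_step s1 e12 n23 d31.
move=> /(h 2) {h}.
have [f34 e34 /type_walks_step h] := type_step s2 e23 n34 d42.
move=> /(h 1) {h}.
rewrite eq_sym in d30.
have [f40 e40 /type_walks_step h] := type_step s3 e34 n40 d30.
move=> /(h 0) /=.
rewrite eqxx orbF andbT => f40E; move: e40; rewrite f40E => /andP[p4 /eqP e].
by move: d41; case/andP: e01 => _ /eqP ->; rewrite e extK // eqxx.
Qed.

Lemma on_short_cycleP (s t : pos) : val t \in nb s -> on_short_cycle s t.
Proof.
have /all_pos/(_ s)/allP h : all (fun s => all (on_short_cycle s) (nb s))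
  (iota 0 28) by vm_compute.
exact: h.
Qed.

Definition gadget_copy (V : eqType) (adj : V -> V -> bool) (f : pos -> V) :=
  (forall s t, f s = f t -> s = t) /\
  (forall s t : pos, val t \in nb s -> adj (f s) (f t)).

(* External edges lie on no cycle of length 4 or 5, so a copy of the gadget uses
   internal edges only and therefore stays inside one gadget. *)
Lemma copy_is_gadget (f : pos -> vertex) : (forall s, size (f s).1 <= k) ->
  gadget_copy (fun x y => y \in nbrs k x) f -> exists w, forall s, f s = (w, s).
Proof.
move=> sf [fi fh].
have fn (s t : pos) : s != t -> f s != f t.
  by move=> st; apply: contraNneq st => /fi ->.
have nbP (s : pos) (t : nat) : t \in nb s -> exists2 t' : pos, val t' = t & val t' \in nb s.
  by move=> ts; exists (Ordinal (nb_lt ts)).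
(* The short gadget cycle through the edge from [s] to [t] is carried injectively to a cycle of the
   same length, so the image of that edge cannot be external. *)
have int (s t : pos) : val t \in nb s -> internal (f s) (f t).
  move=> ts; have := fh _ _ ts; rewrite mem_nbrs => /orP[//|xst].
  have /hasP[_ /nbP[a <- at_] /andP[/fn das]] := on_short_cycleP ts.
  case/hasP=> _ /nbP[b <- ba] /andP[/fn dbt /orP[sb|/andP[/fn dbs]]].
    by case: (no_ext_4cycle (sf s) xst (fh _ _ at_) (fh _ _ ba) (fh _ _ sb)).
  case/hasP=> _ /nbP[c <- cb] /and3P[/fn dca /fn dct sc].
  by case: (no_ext_5cycle (sf s) xst (fh _ _ at_) (fh _ _ ba) (fh _ _ cb)
    (fh _ _ sc)).
have w1 s : (f s).1 = (f ord0).1.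
  apply: (gadget_connected (P := fun s => (f s).1 = (f ord0).1)) s => //.
  by move=> s t /int/andP[/eqP -> _].
exists (f ord0).1 => s.
suff : (f s).2 = s by case: (f s) (w1 s) => a b /= -> ->.
apply: (gadget_rigid (h := fun s => (f s).2)) s => [s t e|s t /int/andP[]//].
by apply: fi; case: (f s) (f t) (w1 s) (w1 t) e => a b [c d] /= -> -> ->.
Qed.

End Copies.

(** * Rigidity of the tower *)

Section Rigidity.
Variables (M : finType) (m : M * dart -> M * dart).

Let R c := (m (c, Rp)).1.
Let T c := (m (c, Tw)).1.
Let p c := (m (c, Par)).1.
Let ch c l := (m (c, Ch l)).1.
Let root c := (m (c, Tw)).2 == Par.
Let leaf c := (m (c, Ch (false, false))).2 != Par.
(** The abstract counterpart of [flip]: up to the parent and down to the sibling with the opposite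
    letter. At a root the parent dart does not lead to a child dart, and [c] stays put. *)
Let fl c := if (m (c, Par)).2 is inr l then ch (p c) (opp l) else c.

(** Each point has its own [k] and [w]; nothing is assumed on how these local pictures fit together.
    The radius 4 is the length of the longest walk compared, in [T_ch0]. *)
Hypothesis loc : forall c, exists k w, [/\ size w <= k,
  forall u d, size u <= 4 ->
    (m (walk m c u, d)).2 = (mu k (walk (mu k) w u, d)).2 &
  forall u u', size u <= 4 -> size u' <= 4 ->
    walk m c u = walk m c u' <-> walk (mu k) w u = walk (mu k) w u'].
Hypothesis root_uniq : forall c c', root c -> root c' -> c = c'.

Lemma mE c d : m (c, d) = ((m (c, d)).1, (m (c, d)).2).
Proof. by case: (m _). Qed.

Lemma parentP c : ~~ root c -> exists l,
  [/\ m (c, Par) = (p c, Ch l), ~~ leaf (p c) & ch (p c) l = c].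
Proof.
have [k [w [sw ty eqw]]] := loc c; rewrite /root /leaf (ty [::]) //.
case: w => [|l u] in sw ty eqw *; first by [].
move=> _; exists l; split.
- by rewrite mE (ty [::] Par).
- by rewrite (ty [:: Par]) //= [_ < _]sw.
- by apply/(eqw [:: Par; Ch l] [::]); rewrite //= [_ < _]sw.
Qed.

Lemma childP c l : ~~ leaf c ->
  [/\ m (c, Ch l) = (ch c l, Par), m (ch c l, Par) = (c, Ch l),
      p (ch c l) = c & ~~ root (ch c l)].
Proof.
have [k [w [sw ty eqw]]] := loc c; rewrite /root /leaf (ty [::]) //= negbK.
case: ltnP => // wk _.
have pc : p (ch c l) = c by apply/(eqw [:: Ch l; Par] [::]); rewrite //= wk.
split=> //.
- by rewrite mE (ty [::] (Ch l)) //= wk.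
- by rewrite mE (ty [:: Ch l]) //= wk /= -[in RHS]pc.
- by rewrite (ty [:: Ch l]) //= wk.
Qed.

Lemma leafP c l : leaf c -> m (c, Ch l) = (c, Ch (opp l)).
Proof.
have [k [w [sw ty eqw]]] := loc c; rewrite /leaf (ty [::]) //=.
case: ltnP => // wk _; rewrite mE (ty [::] (Ch l)) //= ltnNge wk /=.
by congr pair; apply/(eqw [:: Ch l] [::]); rewrite //= ltnNge wk.
Qed.

Lemma leaf_R c : leaf (R c) = leaf c.
Proof.
have [k [w [sw ty eqw]]] := loc c.
by rewrite /leaf (ty [:: Rp]) // (ty [::]) //= size_map; case: ifP.
Qed.

Lemma leaf_T c : leaf (T c) = leaf c.
Proof.
have [k [w [sw ty eqw]]] := loc c.
rewrite /leaf (ty [:: Tw]) // (ty [::]) //=.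
have -> : size (if w is [::] then ([::], Par) else (twist w, Tw)).1 = size w.
  by case: w {sw ty eqw} => // l u; rewrite -[RHS]size_twist.
by case: ifP.
Qed.

Lemma leaf_fl c : leaf (fl c) = leaf c.
Proof.
have [k [w [sw ty eqw]]] := loc c; rewrite /fl (ty [::] Par) //.
case: w => [|l u] /= in sw ty eqw *; first by [].
have su : size u < k by [].
rewrite /leaf (ty [:: Par; Ch (opp l)]) // (ty [::]) //= su /=.
by case: ifP.
Qed.

Lemma R_ch c l : ~~ leaf c -> R (ch c l) = ch (R c) (rot3 l).
Proof.
have [k [w [sw ty eqw]]] := loc c; rewrite /leaf (ty [::]) //= negbK.
case: ltnP => // wk _.
by apply/(eqw [:: Ch l; Rp] [:: Rp; Ch (rot3 l)]); rewrite //= size_map wk.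
Qed.

Lemma T_ch1 c a : ~~ leaf c -> T (ch c (a, true)) = ch (T c) (~~ a, true).
Proof.
have [k [w [sw ty eqw]]] := loc c; rewrite /leaf (ty [::]) //= negbK.
case: ltnP => // wk _.
apply/(eqw [:: Ch (a, true); Tw] [:: Tw; Ch (~~ a, true)]); rewrite //= wk /=.
case: w wk {sw ty eqw} => [|l u] /= wk; first by rewrite wk.
set v := if _ then _ else _.
have sv : size v = size u.
  by rewrite /v; case: ifP => _; rewrite ?size_flip size_twist.
by rewrite sv wk.
Qed.

Lemma T_ch0 c a : ~~ leaf c ->
  T (ch c (a, false)) = ch (fl (T c)) (~~ a, false).
Proof.
have [k [w [sw ty eqw]]] := loc c; rewrite /leaf (ty [::]) //= negbK.
case: ltnP => // wk _; rewrite /fl (ty [:: Tw] Par) //.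
case: w => [|l u] /= in sw wk ty eqw *.
  by apply/(eqw [:: Ch (a, false); Tw] [:: Tw; Ch (~~ a, false)]);
     rewrite //= wk.
(* Twisting has turned the letter [l] into [opp l], and [fl] then applies [opp] once more. *)
apply/(eqw [:: Ch (a, false); Tw]
  [:: Tw; Par; Ch (opp (opp l)); Ch (~~ a, false)]); rewrite //= wk /=.
set v := if _ then _ else _.
have sv : size v = size u.
  by rewrite /v; case: ifP => _; rewrite ?size_flip size_twist.
have su : size u < k by [].
by rewrite sv su /= sv wk.
Qed.

Lemma TK c : T (T c) = c.
Proof.
have [k [w [sw ty eqw]]] := loc c; apply/(eqw [:: Tw; Tw] [::]) => //=.
by case: w {sw ty eqw} => //= l u; rewrite -[in RHS](twistK (l :: u)).
Qed.

Lemma R3 c : R (R (R c)) = c.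
Proof.
have [k [w [sw ty eqw]]] := loc c; apply/(eqw [:: Rp; Rp; Rp] [::]) => //=.
by rewrite -!map_comp -[RHS]map_id; apply: eq_map => -[[] []].
Qed.

Lemma rootP c : root c ->
  [/\ R c = c, m (c, Tw) = (c, Par), m (c, Par) = (c, Tw) & fl c = c].
Proof.
have [k [w [sw ty eqw]]] := loc c; rewrite /root (ty [::]) //.
case: w => [|l u] in sw ty eqw *; last by [].
move=> _; split.
- exact/(eqw [:: Rp] [::]).
- by rewrite mE (ty [::] Tw) //=; congr pair; apply/(eqw [:: Tw] [::]).
- by rewrite mE (ty [::] Par) //=; congr pair; apply/(eqw [:: Par] [::]).
- by rewrite /fl (ty [::] Par).
Qed.

Lemma mRp c : m (c, Rp) = (R c, Rm).
Proof. by have [k [w [sw ty eqw]]] := loc c; rewrite mE (ty [::] Rp). Qed.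

Lemma mRm c : m (R c, Rm) = (c, Rp).
Proof.
have [k [w [sw ty eqw]]] := loc c; rewrite mE (ty [:: Rp] Rm) //=.
congr pair; apply/(eqw [:: Rp; Rm] [::]) => //=.
by rewrite -map_comp (eq_map rot3K) map_id.
Qed.

Lemma mTw c : ~~ root c -> m (c, Tw) = (T c, Tw).
Proof.
have [k [w [sw ty eqw]]] := loc c; rewrite /root (ty [::]) // => r.
by rewrite mE (ty [::] Tw) //; case: w r {sw ty eqw}.
Qed.

Lemma fl_ch c l : ~~ leaf c -> fl (ch c l) = ch c (opp l).
Proof. by move=> lc; have [_ e pc _] := childP l lc; rewrite /fl e /= pc. Qed.

Definition orbit_step c := [:: R c; T c; fl c].
Definition sim : rel M := connect (fun c c' => c' \in orbit_step c).

Lemma sim_R c : sim c (R c).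
Proof. by apply: connect1; rewrite inE eqxx. Qed.
Lemma sim_T c : sim c (T c).
Proof. by apply: connect1; rewrite !inE eqxx orbT. Qed.
Lemma sim_fl c : sim c (fl c).
Proof. by apply: connect1; rewrite !inE eqxx !orbT. Qed.
Lemma sim_trans : transitive sim. Proof. exact: connect_trans. Qed.

Lemma sim_ind (P : M -> Prop) c c' : sim c c' -> P c ->
  (forall x, P x -> P (R x)) -> (forall x, P x -> P (T x)) ->
  (forall x, P x -> P (fl x)) -> P c'.
Proof.
move=> /connectP[s + ->] + hR hT hf; elim: s c => //= y s IHs c.
case/andP=> + /IHs h Pc; rewrite !inE => /or3P[]/eqP e; apply: h; rewrite e.
- exact: hR.
- exact: hT.
- exact: hf.
Qed.

Lemma sim_leaf c c' : sim c c' -> leaf c' = leaf c.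
Proof.
by move=> h; apply: (sim_ind (P := fun x => leaf x = leaf c) h) => // x;
   rewrite ?leaf_R ?leaf_T ?leaf_fl.
Qed.

(** [fl] flips the first coordinate of the letter; conjugated by the rotation it flips the second
    one. The two flips together reach all four children. *)
Lemma sim_sib c l l' : ~~ leaf c -> sim (ch c l) (ch c l').
Proof.
move=> lc; have s1 x : sim (ch c x) (ch c (opp x)).
  by rewrite -fl_ch // sim_fl.
have s2 x : sim (ch c x) (ch c (x.1, ~~ x.2)).
  have -> : ch c (x.1, ~~ x.2) = R (fl (R (R (ch c x)))).
    rewrite !(R_ch, fl_ch) ?leaf_R // R3.
    by case: x => [] [] [].
  by do 2!apply: sim_trans (sim_R _) _; apply: sim_trans (sim_fl _) (sim_R _).
case: l l' => [a b] [a' b'].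
have h y : sim (ch c (a, y)) (ch c (a', y)).
  by have := s1 (a, y); case: a a' => [] [] // _; apply: connect0.
apply: sim_trans (h b) _.
by have := s2 (a', b); case: b b' {h} => [] [] // _; apply: connect0.
Qed.

(* The twist of the four children of [c] reaches the children of both [T c] and
   [fl (T c)]; hence equivalence is inherited by children. *)
Lemma sim_ch c c' l l' : sim c c' -> ~~ leaf c -> sim (ch c l) (ch c' l').
Proof.
move=> cc' lc; pose P x := ~~ leaf x /\ forall y, sim (ch c l) (ch x y).
suff /(_ c' cc') [] : forall x, sim c x -> P x by [].
have PT x : P x -> P (T x).
  move=> [lx h]; split=> [|y]; first by rewrite leaf_T.
  apply: sim_trans (h (true, true)) (sim_trans (sim_T _) _).
  by rewrite T_ch1 // sim_sib // leaf_T.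
move=> x cx; apply: (sim_ind cx) => {x cx}.
- by split=> // y; apply: sim_sib.
- move=> x [lx h]; split=> [|y]; first by rewrite leaf_R.
  apply: sim_trans (h (rot3i y)) (sim_trans (sim_R _) _).
  by rewrite R_ch // rot3iK; apply: connect0.
- exact: PT.
- move=> x /PT[lx h]; split=> [|y]; first by rewrite leaf_fl -leaf_T.
  apply: sim_trans (h (true, false)) (sim_trans (sim_T _) _).
  by rewrite T_ch0 // TK sim_sib // leaf_fl -leaf_T.
Qed.

Fixpoint desc c (u : word) := if u is l :: v then ch (desc c v) l else c.

Lemma desc_cat c u v : desc c (u ++ v) = desc (desc c v) u.
Proof. by elim: u => //= l u ->. Qed.

Lemma ch_inj c c' l l' : ~~ leaf c -> ~~ leaf c' -> ch c l = ch c' l' ->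
  c = c' /\ l = l'.
Proof.
move=> /(childP l)[_ + _ _] /(childP l')[_ + _ _] e.
by rewrite e => -> [-> ->].
Qed.

(** Without leaves, taking children would inject four copies of the finite nonempty set of
    descendants of [x] into that set. *)
Lemma some_leaf x : exists u, leaf (desc x u).
Proof.
apply: contrapT => no; have nl u : ~~ leaf (desc x u).
  by apply/negP => h; apply: no; exists u.
pose A := [set c | `[< exists u, c = desc x u >]].
pose f (y : M * letter) := ch y.1 y.2.
have AP c : reflect (exists u, c = desc x u) (c \in A).
  by rewrite inE; apply: asboolP.
have fA : f @: (finset.setX A [set: letter]) \subset A.
  apply/fintype.subsetP => y /imsetP[[c l] /finset.setXP[/AP[u uE] _] ->].
  by apply/AP; exists (l :: u); rewrite /= -uE.
have injf : {in finset.setX A [set: letter] &, injective f}.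
  move=> [c l] [c' l'] /finset.setXP[/AP[u /= ->] _] /finset.setXP[/AP[u' /= ->] _].
  by case/(ch_inj (nl u) (nl u')) => -> /= ->.
have := subset_leq_card fA; rewrite card_in_imset // cardsX cardsT.
rewrite card_prod card_bool.
suff : 0 < #|A| by lia.
by apply/card_gt0P; exists x; apply/AP; exists [::].
Qed.

Definition open_below x i := forall u, size u < i -> ~~ leaf (desc x u).

(** Iteration of [sim_ch]. As [sim] preserves being a leaf, all leaves below [x] at minimal depth
    fill a whole level. *)
Lemma sim_desc x u v : size u = size v -> open_below x (size u) ->
  sim (desc x u) (desc x v).
Proof.
elim: u v => [|l u IHu] [|l' v] //=; first by move=> _ _; apply: connect0.
case=> suv ob.
apply: sim_ch; last exact: ob.
by apply: IHu => // w sw; apply: ob; rewrite ltnS ltnW.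
Qed.

Lemma iter_p_desc i c : (forall j, ~~ root (iter j p c)) ->
  exists2 u, size u = i & desc (iter i p c) u = c.
Proof.
move=> nr; elim: i => [|i [u su IHu]]; first by exists [::].
have [l [_ _ e]] := parentP (nr i); exists (rcons u l).
  by rewrite size_rcons su.
by rewrite -cats1 desc_cat /= e.
Qed.

(** Otherwise following parents runs into a cycle, which provides a descendant that is not a leaf at
    every depth. Equivalence of descendants at equal depth then removes all leaves, against
    [some_leaf]. *)
Lemma reach_root c : exists i, root (iter i p c).
Proof.
apply: contrapT => no; have nr j : ~~ root (iter j p c).
  by apply/negP => h; apply: no; exists j.
have [i [n n0 e]] : exists i, exists2 n, 0 < n & iter (n + i) p c = iter i p c.
  have /fintype.injectivePn[i [j nij e]] :
      ~~ injectiveb (fun i : 'I_#|M|.+1 => iter i p c).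
    by apply/negP => /fintype.injectiveP/leq_card; rewrite card_ord ltnn.
  wlog ij : i j nij e / i < j.
    move=> h; case: (ltngtP i j) => [||/val_inj]; first exact: h nij e.
      by apply: h (esym e); rewrite eq_sym.
    by move/eqP: nij.
  exists i, (j - i); first by rewrite subn_gt0.
    by rewrite subnK ?(ltnW ij) //; exact: esym e.
set x := iter i p c in e.
have nx j : ~~ root (iter j p x) by rewrite -iterD nr.
have xE t : iter (t * n) p x = x.
  by elim: t => // t IHt; rewrite mulSn iterD IHt /x -iterD; exact: e.
have up t : exists2 u, size u = t & ~~ leaf (desc x u).
  have tn : t < t.+1 * n by apply: leq_pmulr.
  (* [t] more parent steps from [z] complete [t.+1] turns of the cycle and arrive at [x], so [z] is
     [t] levels below [x]. Being the parent of [iter s p x], it is not a leaf. *)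
  pose s := (t.+1 * n - t.+1)%N; pose z := iter s.+1 p x.
  have [|u su du] := @iter_p_desc t z; first by move=> j; rewrite /z -iterD.
  exists u => //; move: du; rewrite /z -iterD (_ : t + s.+1 = t.+1 * n)%N.
    by rewrite xE => ->; have [l []] := parentP (nx s).
  by rewrite /s; lia.
have all_open t : open_below x t.
  elim: t => // t IHt u; rewrite ltnS leq_eqVlt => /predU1P[su|]; last exact: IHt.
  have [v sv lv] := up t; rewrite (sim_leaf (sim_desc (u := v) _ _)) //.
    by rewrite sv su.
  by rewrite sv.
have [u] := some_leaf x; apply/negP; exact: (all_open (size u).+1).
Qed.


(** Words are read as descents from the root, with [K] the least depth of a leaf. Every point is
    reached because its ancestors end in the unique root, and [R], [T], [fl] act as on words by
    induction on the depth. *)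
Theorem rigidity (c0 : M) : exists K (psi : word -> M),
  [/\ forall u v, size u <= K -> size v <= K -> psi u = psi v -> u = v,
      forall c, exists2 u, size u <= K & psi u = c &
      forall u d, size u <= K ->
        m (psi u, d) = (psi (mu K (u, d)).1, (mu K (u, d)).2)].
Proof.
have [i0 r0] := reach_root c0; set r := iter i0 p c0 in r0.
have exK : exists i, `[< exists2 u, size u = i & leaf (desc r u) >].
  have [u lu] := some_leaf r.
  by exists (size u); apply/asboolP; exists u.
case: (ex_minnP exK) => K /asboolP[v0 sv0 lv0] minK.
have ob : open_below r K.
  move=> u; apply: contraTN => lu; rewrite -leqNgt; apply: minK.
  by apply/asboolP; exists u.
have leafK u : size u = K -> leaf (desc r u).
  move=> su; rewrite (sim_leaf (sim_desc (u := v0) _ _)) //.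
    by rewrite su sv0.
  by rewrite sv0.
have [Rr mTr mPr fr] := rootP r0.
have flE u : size u <= K -> fl (desc r u) = desc r (flip u).
  by case: u => [|l u] //= su; rewrite fl_ch ?ob.
have RE u : size u <= K -> R (desc r u) = desc r (map rot3 u).
  elim: u => //= l u IHu su; rewrite R_ch ?ob // IHu //; exact: ltnW.
have TE u : size u <= K -> T (desc r u) = desc r (twist u).
  elim: u => [|[a b] u IHu] su /=; first by rewrite /T mTr.
  have su' : size u <= K by apply: ltnW.
  case: b su => su; first by rewrite T_ch1 ?ob // IHu.
  by rewrite T_ch0 ?ob // IHu // flE // size_twist.
have nroot l u : size u < K -> ~~ root (desc r (l :: u)).
  by move=> su; have [] := childP l (ob _ su).
exists K, (desc r); split.
- elim=> [|l u IHu] [|l' v] //= su sv e.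
  + by move: (nroot l' v sv); rewrite /= -e r0.
  + by move: (nroot l u su); rewrite /= e r0.
  + by have [e1 ->] := ch_inj (ob _ su) (ob _ sv) e; rewrite (IHu v) // ltnW.
- move=> c; have [i] := reach_root c; elim: i c => [|i IHi] c rc.
    by exists [::] => //=; apply: root_uniq.
  case: (boolP (root c)) => [rc'|nrc]; first by exists [::] => //=; apply: root_uniq.
  have [l [_ nl cE]] := parentP nrc.
  have [|u su uE] := IHi (p c); first by rewrite -iterSr.
  exists (l :: u); last by rewrite /= uE.
  rewrite /= ltn_neqAle su andbT; apply: contraNneq nl => e.
  by rewrite -uE leafK.
- move=> u [[[] []]|l] su /=.
  + case: u => [|l u] /= in su *; first by [].
    by have [_ -> _ _] := childP l (ob _ su).
  + case: u => [|l u] in su *; first by [].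
    by rewrite mTw ?nroot // TE.
  + rewrite -[RHS]mRm RE ?size_map //; congr (m (desc r _, _)).
    by rewrite -map_comp (eq_map rot3iK) map_id.
  + by rewrite mRp RE.
  + case: ltnP => su' /=; first by have [] := childP l (ob _ su').
    by rewrite leafP // leafK //; apply/eqP; rewrite eqn_leq su su'.
Qed.

End Rigidity.

(** * Conditions on atomic diagrams as sentences *)

Section Diagrams.
Variables (V : Type) (E : V -> V -> Prop).

Lemma sat_forall_block k (f : formula k) :
  models E (forall_block f) <-> forall e, sat E f e.
Proof.
elim: k f => [|k IHk] f.
  split=> [h e|]; last exact.
  by rewrite (_ : e = @env_nil V) //; apply/funext => -[].
rewrite /= IHk /=; split=> h e; last by move=> a; apply: h.
suff -> : e = env_cons (e ord0) (fun i => e (lift ord0 i)) by [].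
by apply/funext => i; rewrite /env_cons; case: unliftP => [j|] ->.
Qed.

Lemma sat_exists_block l k (f : formula (l + k)) e :
  sat E (exists_block f) e <->
  exists2 e' : 'I_(l + k) -> V, forall j, e' (rshift l j) = e j & sat E f e'.
Proof.
elim: l f => [|l IHl] f /=.
  have r0 j : rshift 0 j = j :> 'I_k by apply: val_inj.
  split=> [h|[e' e'E]]; first by exists e => // j; rewrite r0.
  by rewrite (_ : e' = e) //; apply/funext => j; rewrite -e'E r0.
have rS j : rshift l.+1 j = lift ord0 (rshift l j) :> 'I_(l.+1 + k).
  exact: val_inj.
rewrite IHl /=; split=> [[e' e'E [a h]]|[e' e'E h]].
  exists (env_cons a e') => // j; rewrite rS /env_cons; case: unliftP => [i|].
    by move/lift_inj <-; rewrite e'E.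
  by move/eqP; rewrite eq_sym (negPf (neq_lift _ _)).
exists (fun i => e' (lift ord0 i)); first by move=> j; rewrite -rS e'E.
exists (e' ord0); suff <- : e' = env_cons (e' ord0) (fun i => e' (lift ord0 i)).
  by [].
by apply/funext => i; rewrite /env_cons; case: unliftP => [j|] ->.
Qed.

End Diagrams.

Section QfPredicate.
Variables (m : nat) (i0 : 'I_m).

(** The syntax has no truth constants; [i0 = i0] and its negation replace them. *)
Definition big_and (I : Type) (s : seq I) (f : I -> formula m) :=
  foldr (fun i g => And (f i) g) (Equal i0 i0) s.
Definition big_or (I : Type) (s : seq I) (f : I -> formula m) :=
  foldr (fun i g => Or (f i) g) (Neg (Equal i0 i0)) s.

Lemma qf_big_and (I : Type) (s : seq I) f :
  (forall i, quantifier_free (f i)) -> quantifier_free (big_and s f).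
Proof. by move=> qf; elim: s => //= i s ->; rewrite qf. Qed.

Lemma qf_big_or (I : Type) (s : seq I) f :
  (forall i, quantifier_free (f i)) -> quantifier_free (big_or s f).
Proof. by move=> qf; elim: s => //= i s ->; rewrite qf. Qed.

Lemma sat_big_and (I : eqType) (s : seq I) f V (E : V -> V -> Prop) e :
  sat E (big_and s f) e <-> forall i, i \in s -> sat E (f i) e.
Proof.
elim: s => [|i s IHs] /=; first by split.
rewrite IHs; split=> [[h1 h2] j|h].
  by rewrite inE => /predU1P[->|/h2].
by split=> [|j js]; apply: h; rewrite inE ?eqxx // js orbT.
Qed.

Lemma sat_big_or (I : eqType) (s : seq I) f V (E : V -> V -> Prop) e :
  sat E (big_or s f) e <-> exists2 i, i \in s & sat E (f i) e.
Proof.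
elim: s => [|i s IHs] /=; first by split=> [[]|[]].
rewrite IHs; split=> [[h|[j js h]]|[j]].
- by exists i; rewrite ?inE ?eqxx.
- by exists j; rewrite ?inE ?js ?orbT.
- by rewrite inE => /predU1P[->|js h]; [left|right; exists j].
Qed.

Definition diagram := ({ffun 'I_m * 'I_m -> bool} * {ffun 'I_m * 'I_m -> bool})%type.

Definition diagram_of V (E : V -> V -> Prop) (e : 'I_m -> V) : diagram :=
  ([ffun x => `[< E (e x.1) (e x.2) >]], [ffun x => `[< e x.1 = e x.2 >]]).

Definition literal (b : bool) (f : formula m) := if b then f else Neg f.

Definition has_diagram (d : diagram) : formula m :=
  big_and (enum {: 'I_m * 'I_m})
    (fun x => And (literal (d.1 x) (Edge x.1 x.2))
                  (literal (d.2 x) (Equal x.1 x.2))).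

Lemma sat_literal b f V (E : V -> V -> Prop) e :
  sat E (literal b f) e <-> `[< sat E f e >] = b.
Proof.
case: b => /=; split=> h; [exact/asboolP|exact/asboolP|exact: asboolF|].
by move=> s; rewrite asboolT in h.
Qed.

Lemma sat_has_diagram d V (E : V -> V -> Prop) e :
  sat E (has_diagram d) e <-> diagram_of E e = d.
Proof.
rewrite sat_big_and; split=> [h|<- x _].
  case: d h => d1 d2 h; congr pair; apply/ffunP => x; rewrite ffunE.
    by have [/sat_literal + _] := h x (mem_enum _ _).
  by have [_ /sat_literal +] := h x (mem_enum _ _).
by split; apply/sat_literal; rewrite ffunE.
Qed.

(** There are finitely many diagrams, so [Q] is the disjunction of the conjunctions of literals
    describing those diagrams that satisfy it. *)
Lemma qf_diagram_predicate (Q : diagram -> Prop) : exists2 f : formula m,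
  quantifier_free f & forall V (E : V -> V -> Prop) e,
    sat E f e <-> Q (diagram_of E e).
Proof.
exists (big_or (enum [pred d | `[< Q d >]]) has_diagram).
  apply: qf_big_or => d; apply: qf_big_and => x /=.
  by case: (d.1 x); case: (d.2 x).
move=> V E e; rewrite sat_big_or; split=> [[d]|h].
  by rewrite mem_enum => /asboolP Qd /sat_has_diagram ->.
by exists (diagram_of E e); [rewrite mem_enum; apply/asboolP|apply/sat_has_diagram].
Qed.

End QfPredicate.

Definition glue (X Y V : Type) (e : X -> V) (e' : Y -> V) (i : X + Y) : V :=
  match i with inl x => e x | inr y => e' y end.

(* Any condition whatsoever on the atomic diagram of finitely many vertices is
   equivalent to a quantifier-free formula, so a [Pi_2] sentence may be given by
   such a condition. *)
Lemma pi2_of_diagram (X Y : finType) (x0 : X)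
    (P : (X + Y -> X + Y -> bool) -> (X + Y -> X + Y -> bool) -> Prop) :
  exists2 phi, Pi2 phi & forall n (G : graph n), graph_models G phi <->
    forall e : X -> 'I_n, exists e' : Y -> 'I_n,
      P (fun i j => G (glue e e' i) (glue e e' j))
        (fun i j => glue e e' i == glue e e' j).
Proof.
pose k := #|X|; pose l := #|Y|.
pose iota (i : X + Y) : 'I_(l + k) :=
  match i with inl x => rshift l (enum_rank x)
             | inr y => lshift k (enum_rank y) end.
have [f qf_f fE] := qf_diagram_predicate (iota (inl x0)) (fun d : diagram (l + k) =>
  P (fun i j => d.1 (iota i, iota j)) (fun i j => d.2 (iota i, iota j))).
exists (forall_block (exists_block f)); first by exists k, l, f.
move=> n G; rewrite /graph_models sat_forall_block.
have dE (g : 'I_(l + k) -> 'I_n) (e : X -> 'I_n) (e' : Y -> 'I_n) :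
    (forall x, g (iota (inl x)) = e x) -> (forall y, g (iota (inr y)) = e' y) ->
    sat (fun u v : 'I_n => G u v) f g <->
    P (fun i j => G (glue e e' i) (glue e e' j))
      (fun i j => glue e e' i == glue e e' j).
  move=> ge ge'; rewrite fE /=.
  have gE i : g (iota i) = glue e e' i by case: i => [x|y] /=; [rewrite -ge|rewrite -ge'].
  set a := (X in P X _); set b := (X in P _ X).
  set a' := (X in _ <-> P X _); set b' := (X in _ <-> P _ X).
  have -> : a = a'.
    by apply/funext => i; apply/funext => j; rewrite /a /a' ffunE /= !gE asboolb.
  have -> : b = b'.
    apply/funext => i; apply/funext => j; rewrite /b /b' ffunE /= !gE.
    by apply/asboolP/eqP.
  by [].
split=> [h e|h e].
  have /sat_exists_block[g gE sg] := h (fun i => e (enum_val i)).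
  exists (fun y => g (iota (inr y))); rewrite -(dE g) // => x.
  by rewrite /= gE enum_rankK.
have [e' h'] := h (fun x => e (enum_rank x)); apply/sat_exists_block.
exists (fun i => match fintype.split i with inl y => e' (enum_val y)
                                          | inr x => e x end).
  by move=> j; rewrite (unsplitK (inr j)).
apply/(dE _ (fun x => e (enum_rank x)) e') => // [x|y] /=.
  by rewrite (unsplitK (inr _)).
by rewrite (unsplitK (inl _)) enum_rankK.
Qed.

(** * The sentence and its models *)

(** The universal variables have room for two gadgets, the existential ones for a gadget at the end
    of each walk of at most 5 darts. *)
Notation uvars := (pos + pos)%type.
Notation evars := (5.-bseq dart * pos)%type.

(** The depth [k] is existential, so the sentence does not fix a level. Applied to two gadget
    copies, the condition makes overlapping copies coincide and allows only one root. *)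
Definition diagram_occurs (a q : uvars + evars -> uvars + evars -> bool) :=
  exists k (c : uvars -> vertex), (forall i, size (c i).1 <= k) /\
    forall i j, a (inl i) (inl j) = (c j \in nbrs k (c i)) /\
                q (inl i) (inl j) = (c i == c j).

Definition chart_var (i : option evars) : uvars + evars :=
  if i is Some y then inr y else inl (inl ord0).
Definition chart_vertex k w s (i : option evars) : vertex :=
  if i is Some y then (walk (mu k) w y.1, y.2) else (w, s).

(** The first universal vertex has a neighbourhood like that of [(w, s)] in some level graph: the
    existential vertices supply all gadgets around it. *)
Definition chart_occurs (a q : uvars + evars -> uvars + evars -> bool) :=
  exists k w s, size w <= k /\ forall i j,
    a (chart_var i) (chart_var j) =
      (chart_vertex k w s j \in nbrs k (chart_vertex k w s i)) /\
    q (chart_var i) (chart_var j) =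
      (chart_vertex k w s i == chart_vertex k w s j).

Lemma exists_local_sentence : exists2 phi, Pi2 phi &
  forall n (G : graph n), graph_models G phi <->
    forall e : uvars -> 'I_n, exists e' : evars -> 'I_n,
      let a i j := G (glue e e' i) (glue e e' j) in
      let q i j := glue e e' i == glue e e' j in
      diagram_occurs a q /\ chart_occurs a q.
Proof.
by have [phi] := pi2_of_diagram (inl ord0 : uvars)
  (fun a q : uvars + evars -> uvars + evars -> bool =>
     diagram_occurs a q /\ chart_occurs a q); exists phi.
Qed.

Definition local_sentence : sentence := projT1 (cid2 exists_local_sentence).

Lemma local_sentence_Pi2 : Pi2 local_sentence.
Proof. by rewrite /local_sentence; case: cid2. Qed.

Lemma models_local_sentence n (G : graph n) : graph_models G local_sentence <->
  forall e : uvars -> 'I_n, exists e' : evars -> 'I_n,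
    let a i j := G (glue e e' i) (glue e e' j) in
    let q i j := glue e e' i == glue e e' j in
    diagram_occurs a q /\ chart_occurs a q.
Proof. by rewrite /local_sentence; case: cid2. Qed.

(** Both conditions are witnessed by the level graph itself, with the chart centred at the vertex
    assigned to the first variable. *)
Lemma level_graph_models n (G : graph n) k (lam : 'I_n -> vertex) :
  injective lam -> (forall u, size (lam u).1 <= k) ->
  (forall x, size x.1 <= k -> exists u, lam u = x) ->
  (forall u v, G u v = (lam v \in nbrs k (lam u))) ->
  graph_models G local_sentence.
Proof.
move=> lami laml lams GE; apply/models_local_sentence => e.
pose w := (lam (e (inl ord0))).1; pose s := (lam (e (inl ord0))).2.
have sw : size w <= k by apply: laml.
have /choice[inv invE] : forall y : evars, exists u,
    lam u = (walk (mu k) w y.1, y.2).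
  by move=> y; apply: lams; apply: size_walk.
exists inv; split.
  exists k, (fun i => lam (e i)); split=> // i j.
  by rewrite /= GE (inj_eq lami).
exists k, w, s; split=> // i j.
have gE i' : lam (glue e inv (chart_var i')) = chart_vertex k w s i'.
  by case: i' => [y|] /=; [rewrite invE|rewrite -surjective_pairing].
by rewrite GE !gE -(inj_eq lami) !gE.
Qed.

(** * Finite models of the sentence are level graphs *)

Section Decoding.
Variables (n : nat) (H : graph n).
Hypotheses (degH : bounded_degree 3 H) (satH : graph_models H local_sentence).

Let is_copy (f : pos -> 'I_n) := gadget_copy H f.

Lemma occurs (e : uvars -> 'I_n) : exists k (c : uvars -> vertex),
  (forall i, size (c i).1 <= k) /\ forall i j,
    H (e i) (e j) = (c j \in nbrs k (c i)) /\ (e i == e j) = (c i == c j).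
Proof.
have [e' [[k [c [sc h]]] _]] := (models_local_sentence H).1 satH e.
by exists k, c; split=> // i j; apply: h.
Qed.

(** The two copies are fed to the universal variables; where their diagram occurs, each is a whole
    gadget by [copy_is_gadget]. *)
Lemma copies_occur f f' : is_copy f -> is_copy f' -> exists k w w',
  [/\ size w <= k, size w' <= k,
    forall s t, (f s == f' t) = ((w, s) == (w', t)),
    forall s t, H (f s) (f t) = ((w, t) \in nbrs k (w, s)) &
    forall s t, H (f' s) (f' t) = ((w', t) \in nbrs k (w', s))].
Proof.
move=> cf cf'; have [k [c [sc h]]] := occurs (fun i => match i with inl s => f s
  | inr s => f' s end).
have [|w wE] := @copy_is_gadget k (fun s => c (inl s)) (fun s => sc _).
  case: cf => fi fh; split=> [s t e|s t st].
    by apply: fi; apply/eqP; rewrite (h (inl s) (inl t)).2 e.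
  by rewrite -(h (inl s) (inl t)).1 fh.
have [|w' w'E] := @copy_is_gadget k (fun s => c (inr s)) (fun s => sc _).
  case: cf' => fi fh; split=> [s t e|s t st].
    by apply: fi; apply/eqP; rewrite (h (inr s) (inr t)).2 e.
  by rewrite -(h (inr s) (inr t)).1 fh.
exists k, w, w'; split.
- by have := sc (inl ord0); rewrite wE.
- by have := sc (inr ord0); rewrite w'E.
- by move=> s t; rewrite -wE -w'E -(h (inl s) (inr t)).2.
- by move=> s t; rewrite -!wE -(h (inl s) (inl t)).1.
- by move=> s t; rewrite -!w'E -(h (inr s) (inr t)).1.
Qed.

Lemma copies_eq f f' s t : is_copy f -> is_copy f' -> f s = f' t ->
  s = t /\ f =1 f'.
Proof.
move=> cf cf' /eqP; have [k [w [w' [_ _ e _ _]]]] := copies_occur cf cf'.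
by rewrite e => /eqP[ww st]; split=> // r; apply/eqP; rewrite e ww.
Qed.

(** In a level graph the ports [Tw] and [Par] of one gadget are joined only for the empty word, so
    both copies are the same gadget there. *)
Lemma root_copies_eq f f' : is_copy f -> is_copy f' ->
  H (f (port_pos Tw)) (f (port_pos Par)) ->
  H (f' (port_pos Tw)) (f' (port_pos Par)) -> f =1 f'.
Proof.
move=> cf cf'; have [k [w [w' [_ _ e h h']]]] := copies_occur cf cf'.
have nil v : (v, port_pos Par) \in nbrs k (v, port_pos Tw) -> v = [::].
  rewrite mem_nbrs => /orP[/andP[_]|/andP[_ /eqP]].
    by move/(nb_port (port_pos_ge Tw)).
  by rewrite /ext; have -> : port (v, port_pos Tw).2 = Tw := port_posK Tw; case: v.
rewrite h h' => /nil w0 /nil w'0 s; apply/eqP; rewrite e.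
by rewrite w0 w'0.
Qed.

Definition copies := {c : {ffun pos -> 'I_n} | `[< is_copy c >]}.

Definition copy_fun (c : copies) (s : pos) : 'I_n := val c s.

Lemma copyP (c : copies) : is_copy (copy_fun c).
Proof. by apply/asboolP; apply: (valP c). Qed.

Lemma copy_inj (c c' : copies) s t : copy_fun c s = copy_fun c' t ->
  s = t /\ c = c'.
Proof.
move=> /(copies_eq (copyP c) (copyP c'))[-> e]; split=> //.
by apply/val_inj/ffunP.
Qed.

Lemma copy_of f : is_copy f -> exists c : copies, copy_fun c =1 f.
Proof.
move=> cf; have h : `[< is_copy [ffun s => f s] >].
  apply/asboolP; case: cf => fi fh; split=> [s t|s t]; rewrite !ffunE.
    exact: fi.
  exact: fh.
by exists (exist _ [ffun s => f s] h) => s; rewrite /copy_fun /= ffunE.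
Qed.

(** [Y u] is the gadget copy at the end of the walk [u]. Radius 5 is one more than [rigidity] asks
    for, so that a further dart may be followed after a walk of length 4. *)
Definition is_chart k w (Y : seq dart -> copies) := size w <= k /\
  forall u v s t, size u <= 5 -> size v <= 5 ->
    H (copy_fun (Y u) s) (copy_fun (Y v) t) =
      ((walk (mu k) w v, t) \in nbrs k (walk (mu k) w u, s)) /\
    (copy_fun (Y u) s == copy_fun (Y v) t) =
      ((walk (mu k) w u, s) == (walk (mu k) w v, t)).

Lemma exists_chart x : exists k w Y s, is_chart k w Y /\ copy_fun (Y [::]) s = x.
Proof.
(* Only the first universal variable matters for a chart, so all of them are set to [x]. *)
have [e' [_ [k [w [s [sw h]]]]]] := (models_local_sentence H).1 satH (fun=> x).
pose y (u : seq dart) t := e' (insub_bseq 5 u, t).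
have iE z : size z <= 5 -> insub_bseq 5 z = z :> seq dart.
  by move=> sz; rewrite /insub_bseq -[bseqval _]/(val _) insubdK.
have hy u v t t' : size u <= 5 -> size v <= 5 ->
    H (y u t) (y v t') = ((walk (mu k) w v, t') \in nbrs k (walk (mu k) w u, t)) /\
    (y u t == y v t') = ((walk (mu k) w u, t) == (walk (mu k) w v, t')).
  move=> su sv; have := h (Some (insub_bseq 5 u, t)) (Some (insub_bseq 5 v, t')).
  by rewrite /= !iE.
have cy u : size u <= 5 -> is_copy (y u).
  move=> su; split=> [t t' e|t t' tt'].
    by have := (hy u u t t' su su).2; rewrite e eqxx => /esym/eqP[].
  by rewrite (hy u u t t' su su).1 mem_nbrs /internal /= eqxx tt'.
have /choice[Y YE] : forall u, exists c : copies, size u <= 5 -> copy_fun c =1 y u.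
  move=> u; case: (leqP (size u) 5) => [/cy/copy_of[c cE]|_]; first by exists c.
  by have [c _] := copy_of (cy [::] isT); exists c.
exists k, w, Y, s; split; last first.
  rewrite YE //; have := (h None (Some (insub_bseq 5 [::], s))).2.
  by rewrite /= iE // eqxx => /eqP ->.
split=> // u v t t' su sv; rewrite !YE //; exact: hy.
Qed.

Lemma chart_of c : exists k w Y, is_chart k w Y /\ Y [::] = c.
Proof.
have [k [w [Y [s [ch e]]]]] := exists_chart (copy_fun c ord0).
by have [_ <-] := copy_inj e; exists k, w, Y.
Qed.

(** A port already has two neighbours inside its gadget. A second external edge would give it degree
    4. *)
Lemma ext_edge_uniq (c c1 c2 : copies) d d1 d2 :
  H (copy_fun c (port_pos d)) (copy_fun c1 (port_pos d1)) ->
  H (copy_fun c (port_pos d)) (copy_fun c2 (port_pos d2)) ->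
  c1 = c2 /\ d1 = d2.
Proof.
move=> h1 h2; set x1 := copy_fun c1 _ in h1; set x2 := copy_fun c2 _ in h2.
suff /copy_inj[e ->] : x1 = x2.
  by split=> //; rewrite -[d1]port_posK -[d2]port_posK e.
apply/eqP/negPn/negP => d12.
pose l := [:: x1, x2 & [seq copy_fun c (inord s) | s <- nb (port_pos d)]].
have [ci ch] := copyP c.
have notin c' d' :
    copy_fun c' (port_pos d') \notin [seq copy_fun c (inord s) | s <- nb (port_pos d)].
  apply/negP => /mapP[s sd /copy_inj[e _]].
  have := port_pos_ge d'; rewrite e inordK ?(nb_lt sd) //.
  by rewrite leqNgt (nb_port (port_pos_ge d) sd).
have ul : uniq l.
  rewrite /l 2!cons_uniq in_cons negb_or d12 !notin !andTb.
  rewrite map_inj_in_uniq ?nb_uniq // => s t sd td.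
  move/ci/(congr1 val) => /=; rewrite !inordK //.
    exact: nb_lt td.
  exact: nb_lt sd.
have lH y : y \in l -> H (copy_fun c (port_pos d)) y.
  rewrite !inE => /or3P[/eqP ->|/eqP ->|/mapP[s sd ->]] //.
  by apply: ch; rewrite /= inordK // (nb_lt sd).
have := degH (copy_fun c (port_pos d)); rewrite leqNgt => /negP; apply.
have <- : size l = 4.
  transitivity (size (nb (port_pos d))).+2; last by rewrite size_nb port_pos_ge.
  by rewrite -(size_map (fun s => copy_fun c (inord s))).
rewrite -(card_uniqP ul); apply: subset_leq_card; apply/fintype.subsetP => y yl.
by rewrite inE lH.
Qed.

Lemma exists_matching : exists m : copies * dart -> copies * dart,
  forall c d, H (copy_fun c (port_pos d)) (copy_fun (m (c, d)).1 (port_pos (m (c, d)).2)).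
Proof.
suff /choice[m mP] : forall x : copies * dart, exists y : copies * dart,
    H (copy_fun x.1 (port_pos x.2)) (copy_fun y.1 (port_pos y.2)).
  by exists m => c d; apply: (mP (c, d)).
move=> [c d]; have [k [w [Y [[sw ch] <-]]]] := chart_of c.
exists (Y [:: d], (mu k (w, d)).2) => /=.
rewrite (ch [::] [:: d] _ _ _ _).1 //= mem_nbrs; apply/orP; right.
by rewrite /external port_pos_ge /ext /= port_posK.
Qed.

Lemma walk_rcons (X : Type) (m : X * dart -> X * dart) c u d :
  walk m c (rcons u d) = (m (walk m c u, d)).1.
Proof. by elim: u c => //= d' u IHu c. Qed.

(** External edges of [H] form a matching on the gadget copies, which charts make locally like some
    [mu k]; [rigidity] then names the copies by words. Edges need to be carried only from the level
    graph to [H]: the distance estimate exhibits edges of [H]. *)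
Theorem decode (x0 : 'I_n) : exists K (beta : vertex -> 'I_n),
  [/\ forall x y, size x.1 <= K -> size y.1 <= K -> beta x = beta y -> x = y,
      forall z, exists2 x, size x.1 <= K & beta x = z &
      forall x y, size x.1 <= K -> y \in nbrs K x -> H (beta x) (beta y)].
Proof.
have [m mP] := exists_matching.
(* The chart supplies an external edge of [H] at this port, and [ext_edge_uniq] identifies it with
   the one chosen by [m]. *)
have mY k w Y u d : is_chart k w Y -> size u <= 4 ->
    m (Y u, d) = (Y (rcons u d), (mu k (walk (mu k) w u, d)).2).
  move=> [sw ch] su; have := mP (Y u) d.
  have h : H (copy_fun (Y u) (port_pos d)) (copy_fun (Y (rcons u d))
      (port_pos (mu k (walk (mu k) w u, d)).2)).
    rewrite (ch _ _ _ _ _ _).1 ?size_rcons //; last exact: leqW.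
    rewrite mem_nbrs walk_rcons; apply/orP; right.
    by rewrite /external port_pos_ge /ext /= port_posK.
  by move=> /(ext_edge_uniq h)[-> ->]; case: (m _).
have wY k w Y u : is_chart k w Y -> size u <= 5 -> walk m (Y [::]) u = Y u.
  move=> ch; elim/last_ind: u => // u d IHu; rewrite size_rcons => su.
  by rewrite walk_rcons IHu ?(ltnW su) // (mY _ _ _ _ _ ch su).
have loc c : exists k w, [/\ size w <= k,
    forall u d, size u <= 4 ->
      (m (walk m c u, d)).2 = (mu k (walk (mu k) w u, d)).2 &
    forall u u', size u <= 4 -> size u' <= 4 ->
      walk m c u = walk m c u' <-> walk (mu k) w u = walk (mu k) w u'].
  have [k [w [Y [ch <-]]]] := chart_of c; exists k, w; split; first by case: ch.
    by move=> u d su; rewrite (wY _ _ _ _ ch) ?(leqW su) // (mY _ _ _ _ _ ch su).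
  move=> u u' su su'; have su5 := leqW su; have su5' := leqW su'.
  rewrite !(wY _ _ _ _ ch) //.
  have e s := (ch.2 u u' s s (leqW su) (leqW su')).2.
  split=> h; first by have := e ord0; rewrite h eqxx => /esym/eqP[].
  by have := e ord0; rewrite h eqxx => /eqP/copy_inj[].
have runiq c c' : (m (c, Tw)).2 == Par -> (m (c', Tw)).2 == Par -> c = c'.
  have rE c1 : (m (c1, Tw)).2 == Par -> H (copy_fun c1 (port_pos Tw))
      (copy_fun c1 (port_pos Par)).
    move=> r1; have := mP c1 Tw; rewrite (eqP r1).
    suff -> : (m (c1, Tw)).1 = c1 by [].
    have [k [w [sw ty eqw]]] := loc c1; apply/(eqw [:: Tw] [::]) => //=.
    by move: r1; rewrite (ty [::] Tw) //=; case: w {sw ty eqw}.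
  move=> /rE h1 /rE h2; have e := root_copies_eq (copyP c) (copyP c') h1 h2.
  by have [] := copy_inj (e ord0).
have [_ [_ [Y0 _]]] := exists_chart x0.
have [K [psi [psi_inj psi_surj psi_mu]]] := rigidity loc runiq (Y0 [::]).
exists K, (fun x => copy_fun (psi x.1) x.2); split.
- by move=> [w s] [w' s'] /= sw sw' /copy_inj[-> /psi_inj ->].
- move=> z; have [k [w [Y [s [_ <-]]]]] := exists_chart z.
  by have [u su <-] := psi_surj (Y [::]); exists (u, s).
- move=> x y sx; rewrite mem_nbrs => /orP[/andP[/eqP -> yx]|/andP[x20 /eqP ->]].
    by have [_] := copyP (psi y.1); apply.
  have := mP (psi x.1) (port x.2); by rewrite psi_mu //= portK.
Qed.

End Decoding.

(** * Expansion of the bottom level *)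

Section Walsh.
Variable F : realFieldType.
Local Open Scope ring_scope.

Definition sum_letter (f : letter -> F) : F :=
  f (false, false) + f (true, false) + f (false, true) + f (true, true).

Fixpoint sumw (k : nat) (f : word -> F) : F :=
  if k is k'.+1 then sum_letter (fun l => sumw k' (fun u => f (l :: u)))
  else f [::].

Definition sgn (b : bool) : F := if b then -1 else 1.
Definition pair2 (z l : letter) : bool := (z.1 && l.1) (+) (z.2 && l.2).
Definition chl z l : F := sgn (pair2 z l).

(** The unnormalised Walsh transform on words of length [k]; [chl] gives the characters of a single
    letter. *)
Fixpoint hat (k : nat) (f : word -> F) (z : word) : F :=
  if k is k'.+1 then
    sum_letter (fun l => chl (head (false, false) z) l *
                 hat k' (fun u => f (l :: u)) (behead z))
  else f [::].

Lemma eq_sumw k f g : (forall u, size u = k -> f u = g u) ->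
  sumw k f = sumw k g.
Proof.
elim: k f g => [|k IHk] f g fg /=; first exact: fg.
by rewrite /sum_letter; congr (_ + _ + _ + _); apply: IHk => u su;
   apply: fg; rewrite /= su.
Qed.

Lemma le_sumw k f g : (forall u, size u = k -> f u <= g u) ->
  sumw k f <= sumw k g.
Proof.
elim: k f g => [|k IHk] f g fg /=; first exact: fg.
by rewrite /sum_letter !lerD //; apply: IHk => u su; apply: fg; rewrite /= su.
Qed.

Lemma sumwD k f g : sumw k (fun u => f u + g u) = sumw k f + sumw k g.
Proof.
by elim: k f g => //= k IHk f g; rewrite /sum_letter !IHk; ring.
Qed.

Lemma sumwZ k c f : sumw k (fun u => c * f u) = c * sumw k f.
Proof. by elim: k f => //= k IHk f; rewrite /sum_letter !IHk; ring. Qed.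

Lemma sumw_ge0 k f : (forall u, 0 <= f u) -> 0 <= sumw k f.
Proof.
elim: k f => //= k IHk f f0.
by rewrite /sum_letter !addr_ge0 //; apply: IHk => u.
Qed.

Lemma hatB k f g z : hat k (fun u => f u - g u) z = hat k f z - hat k g z.
Proof. by elim: k f g z => //= k IHk f g z; rewrite /sum_letter !IHk; ring. Qed.

Lemma sumw_map k (h : letter -> letter) f : injective h ->
  sumw k (fun u => f (map h u)) = sumw k f.
Proof.
move=> hi; elim: k f => //= k IHk f.
rewrite /sum_letter !(IHk (fun u => f (_ :: u))).
pose s l := sumw k (fun u => f (l :: u)); rewrite -!/(s _).
move: (hi (false, false) (true, false)) (hi (false, false) (false, true))
  (hi (false, false) (true, true)) (hi (true, false) (false, true))
  (hi (true, false) (true, true)) (hi (false, true) (true, true)).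
case: (h _) (h _) (h _) (h _) => [[] []] [[] []] [[] []] [[] []];
  move=> h1 h2 h3 h4 h5 h6; first
  [ by have := h1 erefl | by have := h2 erefl | by have := h3 erefl
  | by have := h4 erefl | by have := h5 erefl | by have := h6 erefl | ring ].
Qed.

Lemma parseval k f :
  sumw k (fun z => hat k f z ^+ 2) = 4 ^+ k * sumw k (fun u => f u ^+ 2).
Proof.
elim: k f => [|k IHk] f; first by rewrite /= mul1r.
rewrite /= /sum_letter /=.
set A := fun l u => f (l :: u).
rewrite -!sumwD.
transitivity (sumw k (fun z => 4 * (hat k (A (false,false)) z ^+ 2 +
   hat k (A (true,false)) z ^+ 2 + hat k (A (false,true)) z ^+ 2 +
   hat k (A (true,true)) z ^+ 2))).
  by apply: eq_sumw => u _; rewrite /chl /pair2 /sgn /=; ring.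
by rewrite sumwZ !sumwD !IHk exprS -/A; ring.
Qed.

Lemma hat_rot k f z :
  hat k (fun u => f (map rot3 u)) z = hat k f (map rot3i z).
Proof.
elim: k f z => //= k IHk f z; rewrite /sum_letter /=.
rewrite !(IHk (fun u => f (_ :: u))) -behead_map.
have -> : head (false, false) (map rot3i z) = rot3i (head (false, false) z).
  by case: z.
by case: (head _ z) => [] [] []; rewrite /chl /pair2 /sgn /=; ring.
Qed.

Definition flip2 (w : word) : word :=
  if w is l :: u then (l.1, ~~ l.2) :: u else [::].

Lemma hat_flip k f z : size z = k ->
  hat k (fun u => f (flip u)) z = sgn (head (false, false) z).1 * hat k f z.
Proof.
case: k z => [|k] [|[a b] z] //= _; first by rewrite mul1r.
rewrite /sum_letter /chl /pair2 /sgn /opp /=.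
by case: a b => [] [] /=; ring.
Qed.

Lemma hat_flip2 k f z : size z = k ->
  hat k (fun u => f (flip2 u)) z = sgn (head (false, false) z).2 * hat k f z.
Proof.
case: k z => [|k] [|[a b] z] //= _; first by rewrite mul1r.
rewrite /sum_letter /chl /pair2 /sgn /opp /=.
by case: a b => [] [] /=; ring.
Qed.

(** The transpose of the linear part of [twist]: influence now runs from a letter to the one before
    it. *)
Fixpoint twist_dual (z : word) : word :=
  if z is l :: u then (l.1, l.2 (+) (head (false, false) u).1) :: twist_dual u
  else [::].

Lemma size_twist_dual z : size (twist_dual z) = size z.
Proof. by elim: z => //= l u ->. Qed.

Lemma head_twist_dual z :
  (head (false, false) (twist_dual z)).1 = (head (false, false) z).1.
Proof. by case: z. Qed.

(** The character value at the translation part of [twist]. The sum telescopes to the first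
    coordinate of the head. *)
Fixpoint twist_sgn (z : word) : bool :=
  if z is l :: u then twist_sgn u (+) (l.1 (+) (head (false, false) u).1)
  else false.

Lemma hat_twist k f z : size z = k ->
  hat k (fun u => f (twist u)) z = sgn (twist_sgn z) * hat k f (twist_dual z).
Proof.
elim: k f z => [|k IHk] f [|[a b] z] //=; first by rewrite mul1r.
move=> [sz]; rewrite /sum_letter /opp /=.
rewrite !(IHk (fun u => f (_ :: u))) // !(IHk (fun u => f (_ :: flip u))) //.
rewrite !(hat_flip (fun u => f (_ :: u))) ?size_twist_dual // head_twist_dual.
rewrite /chl /pair2 /sgn /=.
case: (twist_sgn z); case: (head _ z).1; case: a; case: b => /=.
all: ring.
Qed.

Lemma sumw_twist_dual k f : sumw k (fun z => f (twist_dual z)) = sumw k f.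
Proof.
elim: k f => //= k IHk f; rewrite /sum_letter /= -!sumwD.
pose G v := sum_letter (fun l => f ((l.1, l.2 (+) (head (false, false) v).1) :: v)).
transitivity (sumw k G).
  rewrite -[RHS]IHk; apply: eq_sumw => u _.
  by rewrite /G head_twist_dual.
apply: eq_sumw => u _; rewrite /G /sum_letter /=.
by case: (head _ u).1 => /=; ring.
Qed.

Fixpoint lead (z : word) : letter :=
  if z is l :: u then if l == (false, false) then lead u else l
  else (false, false).

Lemma lead_map_rot3i z : lead (map rot3i z) = rot3i (lead z).
Proof.
elim: z => //= l u ->.
by rewrite -(inj_eq (can_inj rot3iK) l (false, false)); case: ifP.
Qed.

(** The last zero letter before the leading one receives its first coordinate, which is 1, as second
    coordinate; earlier letters stay zero. *)
Lemma lead_twist_dual l z : (lead z).1 -> head l z = (false, false) ->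
  lead (twist_dual z) = (false, true).
Proof.
case: z => //= x z + e; rewrite {}e eqxx.
by elim: z => //= -[[] []] z IHz.
Qed.

Lemma lead_eq0 z : lead z = (false, false) -> z = nseq (size z) (false, false).
Proof. by elim: z => //= l u IHu; case: eqP => [-> /IHu <- | ]. Qed.

Lemma hat0 k f : hat k f (nseq k (false, false)) = sumw k f.
Proof.
elim: k f => //= k IHk f; rewrite /sum_letter !IHk /chl /pair2 /sgn /=; ring.
Qed.

(** The inequality of Young with weights 1 + 1/10 and 1 + 10. *)
Lemma sqr_perturb (a b : F) (s : bool) :
  a ^+ 2 <= 11 / 10 * b ^+ 2 + 11 * (sgn s * b - a) ^+ 2.
Proof.
by case: s; rewrite /sgn; [have := sqr_ge0 (10 * a + 11 * b)|
  have := sqr_ge0 (10 * a - 11 * b)]; nra.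
Qed.

Section Gap.
Variables (k : nat) (f : word -> F).
Hypothesis f0 : sumw k f = 0.

Let mass (X : pred word) := sumw k (fun z => (X z)%:R * hat k f z ^+ 2).
Definition energy (g : word -> word) := sumw k (fun u => (f (g u) - f u) ^+ 2).

Lemma mass_ge0 X : 0 <= mass X.
Proof. by apply: sumw_ge0 => z; rewrite mulr_ge0 ?sqr_ge0 ?ler0n. Qed.

Lemma energy_ge0 g : 0 <= energy g.
Proof. by apply: sumw_ge0 => z; rewrite sqr_ge0. Qed.

Lemma energyE g : 4 ^+ k * energy g =
  sumw k (fun z => (hat k (fun u => f (g u)) z - hat k f z) ^+ 2).
Proof. by rewrite /energy -parseval; apply: eq_sumw => z _; rewrite hatB. Qed.

(** A map acting on frequencies through [gs] and signs turns mass on [X] into mass on [Y], up to a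
    factor 11/10 and the energy of the map. *)
Lemma mass_transfer (g gs : word -> word) (s : word -> bool) (X Y : pred word) :
  (forall z, size z = k ->
     hat k (fun u => f (g u)) z = sgn (s z) * hat k f (gs z)) ->
  (forall h, sumw k (fun z => h (gs z)) = sumw k h) ->
  (forall z, size z = k -> X z -> Y (gs z)) ->
  mass X <= 11 / 10 * mass Y + 11 * (4 ^+ k * energy g).
Proof.
move=> hg gsum XY; rewrite energyE /mass.
rewrite -(gsum (fun z => (Y z)%:R * hat k f z ^+ 2)) -!sumwZ -sumwD.
apply: le_sumw => z sz; rewrite hg //.
have := XY z sz; have := sqr_perturb (hat k f z) (hat k f (gs z)) (s z).
have := sqr_ge0 (hat k f (gs z)).
have := sqr_ge0 (sgn (s z) * hat k f (gs z) - hat k f z).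
move: (hat k f z ^+ 2) (hat k f (gs z) ^+ 2) (_ ^+ 2) => a b d d0 b0 h {sz}.
case: (X z) => [/(_ isT) ->|_]; first by rewrite !mul1r.
by case: (Y _); rewrite /=; lra.
Qed.

Lemma mass_flip (g : word -> word) (s : pred word) :
  (forall z, size z = k ->
     hat k (fun u => f (g u)) z = sgn (s z) * hat k f z) ->
  4 * mass s = 4 ^+ k * energy g.
Proof.
move=> hg; rewrite energyE /mass -sumwZ; apply: eq_sumw => z sz.
by rewrite hg //; case: (s z); rewrite /sgn /=; ring.
Qed.

(** A Poincaré inequality: the classes [L l] of frequencies by leading letter carry all the mass,
    and the rotation and the twist impose incompatible inequalities on them unless the energies are
    large. *)
Theorem spectral_gap : sumw k (fun u => f u ^+ 2) <=
  150 * (energy (map rot3) + energy twist + energy flip + energy flip2).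
Proof.
pose L l : pred word := fun z => lead z == l.
pose X : pred word := fun z => (lead z).1 && (head (false, false) z == (false, false)).
pose h1 : pred word := fun z => (head (false, false) z).1.
pose h2 : pred word := fun z => (head (false, false) z).2.
have Rt l : mass (L l) <= 11 / 10 * mass (L (rot3i l)) +
    11 * (4 ^+ k * energy (map rot3)).
  apply: (mass_transfer (gs := map rot3i) (s := fun=> false)).
  - by move=> z _; rewrite hat_rot /sgn mul1r.
  - by move=> h; apply: sumw_map (can_inj rot3iK).
  - by move=> z _ /eqP <-; rewrite /L lead_map_rot3i.
have Tt : mass X <= 11 / 10 * mass (L (false, true)) +
    11 * (4 ^+ k * energy twist).
  apply: (mass_transfer (gs := twist_dual) (s := twist_sgn)).
  - by move=> z; apply: hat_twist.
  - exact: sumw_twist_dual.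
  - by move=> z _ /andP[h /eqP e]; apply/eqP/(lead_twist_dual h e).
have e1 : 4 * mass h1 = 4 ^+ k * energy flip.
  by apply: mass_flip => z; apply: hat_flip.
have e2 : 4 * mass h2 = 4 ^+ k * energy flip2.
  by apply: mass_flip => z; apply: hat_flip2.
have ge0 := mass_ge0.
(* If the head is nonzero it is caught by [h1] or [h2]; if it is zero, the leading letter has first
   coordinate 1 and the frequency lies in [X]. *)
have split1 : mass (L (true, false)) + mass (L (true, true)) <=
    mass X + mass h1 + mass h2.
  rewrite /mass -!sumwD; apply: le_sumw => z _; rewrite /L /X /h1 /h2.
  have := sqr_ge0 (hat k f z); move: (_ ^+ 2) => a a0.
  by case: (lead z) => [] [] []; case: (head _ z) => [] [] [] /=; lra.
have tot : 4 ^+ k * sumw k (fun u => f u ^+ 2) =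
    mass (L (true, false)) + mass (L (false, true)) + mass (L (true, true)).
  rewrite -parseval /mass -!sumwD; apply: eq_sumw => z sz; rewrite /L.
  case e : (lead z) => [a b]; case: a b e => [] [] /= e; try ring.
  by rewrite (lead_eq0 e) sz hat0 f0; ring.
(* Up to energies, the masses of (1,0) and (1,1) are at least 1/1.1 and 1/1.21 of the mass of (0,1),
   while their sum is at most 1.1 times it. As 1/1.1 + 1/1.21 > 1.1, all three are bounded by
   energies. *)
move: (Rt (true, false)) (Rt (false, true)) (Rt (true, true)).
rewrite /rot3i /= => r1 r2 r3.
have c0 : 0 < 4 ^+ k :> F by rewrite exprn_gt0 // ltr0n.
rewrite -(ler_pM2l c0) tot mulrCA !mulrDr.
have q0 g : 0 <= 4 ^+ k * energy g by rewrite mulr_ge0 ?energy_ge0 // ltW.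
move: (q0 (map rot3)) (q0 twist) (q0 flip) (q0 flip2).
move: (ge0 (L (true, false))) (ge0 (L (false, true))) (ge0 (L (true, true))).
move: (ge0 X) (ge0 h1) (ge0 h2).
by lra.
Qed.

End Gap.
End Walsh.

(** * Indistinguishability by few queries *)

Lemma uniq_map_inj (T1 T2 : eqType) (f : T1 -> T2) (s : seq T1) :
  uniq (map f s) -> {in s &, injective f}.
Proof.
elim: s => [|x s IHs] //= /andP[fx us] y z; rewrite !inE.
move=> /predU1P[->|ys] /predU1P[->|zs] // e; last exact: IHs.
  by move: fx; rewrite e map_f.
by move: fx; rewrite -e map_f.
Qed.

Section PrescribedPerms.
Variable n : nat.
Implicit Types (s : seq ('I_n * 'I_n)).

Definition prescribed s : {set {perm 'I_n}} :=
  [set p : {perm 'I_n} | all (fun x => p x.1 == x.2) s]%SET.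

Lemma in_prescribed s p :
  (p \in prescribed s) = all (fun x => p x.1 == x.2) s.
Proof. by rewrite inE. Qed.

Lemma card_split_value (A : {set {perm 'I_n}}) v :
  #|A| = \sum_(b : 'I_n) #|[set p in A | p v == b]%SET|.
Proof.
rewrite -sum1_card (partition_big (fun p : {perm 'I_n} => p v) predT) //=.
by apply: eq_bigr => b _; rewrite -sum1_card; apply: eq_bigl => p; rewrite inE.
Qed.

Lemma card_split_label (A : {set {perm 'I_n}}) b :
  #|A| = \sum_(v : 'I_n) #|[set p in A | p v == b]%SET|.
Proof.
rewrite -sum1_card (partition_big (fun p : {perm 'I_n} => (p^-1)%g b) predT) //=.
apply: eq_bigr => v _; rewrite -sum1_card; apply: eq_bigl => p; rewrite inE.
by congr andb; apply/eqP/eqP => [<-|<-]; rewrite ?permKV ?permK.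
Qed.

(** Induction on [s]: composing with a transposition shows that all values not yet used are equally
    frequent at the new argument, and used values do not occur. *)
Lemma card_prescribed s : uniq (unzip1 s) -> uniq (unzip2 s) ->
  #|prescribed s| = (n - size s)`!.
Proof.
elim: s => [|[v a] s IHs] /=.
  move=> _ _; rewrite subn0 -card_Sn; apply: eq_card => p.
  by rewrite in_prescribed.
move=> /andP[vs u1] /andP[as_ u2].
have sn : size s < n.
  have := max_card [in a :: unzip2 s]; rewrite card_ord.
  by rewrite (card_uniqP _) /= ?as_ //= size_map.
have same b : b \notin unzip2 s ->
    #|prescribed ((v, b) :: s)| = #|prescribed ((v, a) :: s)|.
  move=> bs; pose f (p : {perm 'I_n}) := (p * tperm a b)%g.
  have fi : injective f by apply: mulIg.
  rewrite -(card_imset _ fi); apply: eq_card => p.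
  apply/imsetP/idP => [[p' + ->]|].
    rewrite !in_prescribed /= => /andP[/eqP p'v /allP h].
    rewrite permM p'v tpermR eqxx; apply/allP => x xs.
    rewrite permM (eqP (h x xs)) tpermD //.
      by apply: contraNneq as_ => ->; apply: map_f.
    by apply: contraNneq bs => ->; apply: map_f.
  rewrite !in_prescribed /= => /andP[/eqP pv /allP h].
  exists (f p); last by rewrite /f -mulgA tperm2 mulg1.
  rewrite in_prescribed /= permM pv tpermL eqxx; apply/allP => x xs.
  rewrite permM (eqP (h x xs)) tpermD //.
    by apply: contraNneq as_ => ->; apply: map_f.
  by apply: contraNneq bs => ->; apply: map_f.
have := IHs u1 u2; rewrite (card_split_value _ v).
rewrite (bigID (fun b => b \in unzip2 s)) /= big1 => [|b /mapP[x xs ->]].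
  rewrite add0n (eq_bigr (fun=> #|prescribed ((v, a) :: s)|)).
    rewrite sum_nat_const.
    have -> : #|[pred b | b \notin unzip2 s]| = n - size s.
      have := cardC [in unzip2 s]; rewrite card_ord (card_uniqP u2) size_map.
      by move=> e; apply: (@addnI (size s)); rewrite subnKC ?(ltnW sn).
    rewrite subnS; case: (n - size s) (subn_gt0 (size s) n) => [|m]; first by rewrite sn.
    by move=> _ /eqP; rewrite factS eqn_mul2l /= => /eqP.
  move=> b bs; rewrite -(same b bs); apply: eq_card => p.
  by rewrite !inE /= andbC.
apply/eqP; rewrite cards_eq0; apply/eqP/setP => p; rewrite !inE.
apply/negP => /andP[/allP h /eqP pv].
have : p v = p x.1 by rewrite pv (eqP (h x xs)).
by move/perm_inj => e; move: vs; rewrite e map_f.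
Qed.

End PrescribedPerms.

Section Trees.
Variables (n d : nat).

Fixpoint depth_le (t : decision_tree n d) (D : nat) : Prop :=
  match t with
  | Answer _ => True
  | Query v i next => if D is D'.+1 then forall o, depth_le (next o) D' else False
  end.

(** The query bound holds only for oracles of graphs of bounded degree. The induction below follows
    all answers and needs an absolute bound on the depth. *)
Fixpoint truncate (t : decision_tree n d) (D : nat) : decision_tree n d :=
  match t with
  | Answer b => Answer n d b
  | Query v i next =>
      if D is D'.+1 then Query v i (fun o => truncate (next o) D')
      else Answer n d false
  end.

Lemma depth_truncate t D : depth_le (truncate t D) D.
Proof. by elim: t D => //= v i next IH [|D] //= o; apply: IH. Qed.

Lemma accepts_truncate g t D :
  num_queries g t <= D -> accepts g (truncate t D) = accepts g t.
Proof. by elim: t D => //= v i next IH [|D] //= h; apply: IH. Qed.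

End Trees.

Section Coupling.
Variables (n d : nat) (rho rho' : 'I_n -> 'I_d -> 'I_n).
Implicit Types (c : 'I_n) (u : seq 'I_d) (r : 'I_n -> 'I_d -> 'I_n).
Implicit Types (t : decision_tree n d).

(** Label [v] is carried by vertex [p v]; answers are translated back to labels. *)
Definition relabelled r (p : {perm 'I_n}) : oracle n d :=
  fun v i => Some ((p^-1)%g (r (p v) i)).

Variables (L kappa q : nat).

(** Equal coincidences among walks mean isomorphic balls with their port numbering. *)
Definition same_ball c := forall u u', size u <= L -> size u' <= L ->
  foldl rho c u = foldl rho c u' <-> foldl rho' c u = foldl rho' c u'.

Definition apart c c' := forall u u', size u <= L -> size u' <= L ->
  foldl rho c u <> foldl rho c' u' /\ foldl rho' c u <> foldl rho' c' u'.

Definition admissible (C : seq 'I_n) c :=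
  same_ball c /\ forall c', c' \in C -> apart c c'.

Hypothesis few_inadmissible : forall C : seq 'I_n, size C <= q.*2 ->
  #|[set c | ~~ `[< admissible C c >]]%SET| <= kappa.
Hypothesis qL : q <= L.

(* Knowledge gathered so far: entry [(v, c, u)] says that label [v] is carried by
   the vertex reached from [c] by following the ports [u]. *)
Definition state := seq ('I_n * 'I_n * seq 'I_d).
Implicit Types (st : state).

Definition label (e : 'I_n * 'I_n * seq 'I_d) := e.1.1.
Definition center (e : 'I_n * 'I_n * seq 'I_d) := e.1.2.
Definition place r (e : 'I_n * 'I_n * seq 'I_d) := foldl r (center e) e.2.
Definition assignment r st := [seq (label e, place r e) | e <- st].

(** Everything revealed lies in balls that are equal in both graphs and either share their centre or
    are disjoint. Hence distinctness of places passes from [rho] to [rho']. *)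
Definition coherent st len :=
  [/\ uniq (map label st), uniq (map (place rho) st),
      forall e, e \in st -> size e.2 <= len,
      forall e, e \in st -> same_ball (center e) &
      forall e e', e \in st -> e' \in st ->
        center e = center e' \/ apart (center e) (center e')].

Lemma same_place st len c u c' u' : coherent st len ->
  c \in map center st -> c' \in map center st ->
  size u <= L -> size u' <= L ->
  foldl rho c u = foldl rho c' u' <-> foldl rho' c u = foldl rho' c' u'.
Proof.
move=> [_ _ _ sb ap] /mapP[e est ->] /mapP[e' e'st ->] su su'.
have [<-|/(_ u u' su su')[]//] := ap e e' est e'st; exact: sb est _ _ su su'.
Qed.

Lemma uniq_place' st len : len <= L -> coherent st len ->
  uniq (map (place rho') st).
Proof.
move=> lenL coh; have [ul up sz _ _] := coh.
rewrite map_inj_in_uniq ?(map_uniq ul) // => e e' est e'st h.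
apply: (uniq_map_inj up) => //; apply/(same_place coh) => //.
- exact: map_f.
- exact: map_f.
- exact: leq_trans (sz _ est) lenL.
- exact: leq_trans (sz _ e'st) lenL.
Qed.

Definition accepting r st t : {set {perm 'I_n}} :=
  [set p in prescribed (assignment r st) | accepts (relabelled r p) t]%SET.

Lemma in_accepting r st t p : (p \in accepting r st t) =
  all (fun e => p (label e) == place r e) st && accepts (relabelled r p) t.
Proof. by rewrite !inE all_map. Qed.

Lemma accepting_cons r st t e : accepting r (e :: st) t =
  [set p in accepting r st t | p (label e) == place r e]%SET.
Proof. by apply/setP => p; rewrite inE !in_accepting /= -andbA andbC. Qed.

Lemma card_accepting_known r st v c u i next e :
  (v, c, u) \in st -> e \in st -> place r e = foldl r c (rcons u i) ->
  accepting r st (Query v i next) = accepting r st (next (Some (label e))).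
Proof.
move=> vst est pe; apply/setP => p; rewrite !in_accepting.
case: allP => //= h; have /eqP pv := h _ vst; have /eqP pl := h _ est.
by rewrite /relabelled pv /place /= -foldl_rcons -pe -pl permK.
Qed.

Lemma card_accepting_new r st v c u i next : (v, c, u) \in st ->
  #|accepting r st (Query v i next)| =
  \sum_(l : 'I_n) #|accepting r ((l, c, rcons u i) :: st) (next (Some l))|.
Proof.
move=> vst; rewrite (card_split_label _ (foldl r c (rcons u i))).
apply: eq_bigr => l _; apply: eq_card => p; rewrite accepting_cons !inE !all_map.
rewrite /label /place /=; case: eqP => [pl|_]; last by rewrite !andbF.
rewrite !andbT; case: allP => //= h; have /eqP pv := h _ vst.
by rewrite /relabelled pv /place /= -foldl_rcons -pl permK.
Qed.

Lemma card_accepting_fresh r st t v :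
  #|accepting r st t| = \sum_(c : 'I_n) #|accepting r ((v, c, [::]) :: st) t|.
Proof.
rewrite (card_split_value _ v); apply: eq_bigr => c _.
by rewrite accepting_cons.
Qed.

Lemma accepting_le r st t : uniq (map label st) -> uniq (map (place r) st) ->
  #|accepting r st t| <= (n - size st)`!.
Proof.
move=> ul up; rewrite -(size_map (fun e => (label e, place r e)) st).
rewrite -card_prescribed; last 2 first.
- by rewrite /unzip1 -map_comp.
- by rewrite /unzip2 -map_comp.
by apply: subset_leq_card; apply/fintype.subsetP => p; rewrite inE => /andP[].
Qed.

Lemma accepting_answer r st b : uniq (map label st) -> uniq (map (place r) st) ->
  #|accepting r st (Answer n d b)| = if b then (n - size st)`! else 0.
Proof.
move=> ul up; case: b.
  rewrite -(size_map (fun e => (label e, place r e)) st).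
  rewrite -card_prescribed; last 2 first.
  - by rewrite /unzip1 -map_comp.
  - by rewrite /unzip2 -map_comp.
  by apply: eq_card => p; rewrite inE andbT.
by apply: eq_card0 => p; rewrite inE andbF.
Qed.

Lemma accepting0 r st t e : label e \in map label st ->
  place r e \notin map (place r) st -> #|accepting r (e :: st) t| = 0.
Proof.
move=> /mapP[e' e'st ll] pe; apply: eq_card0 => p; rewrite in_accepting /=.
apply/negP => /andP[/andP[/eqP h1 /allP h2] _].
by move: pe; rewrite -h1 ll (eqP (h2 _ e'st)) map_f.
Qed.

Lemma accepting0' r st t e : label e \notin map label st ->
  place r e \in map (place r) st -> #|accepting r (e :: st) t| = 0.
Proof.
move=> pe /mapP[e' e'st ll]; apply: eq_card0 => p; rewrite in_accepting /=.
apply/negP => /andP[/andP[/eqP h1 /allP h2] _].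
move: h1; rewrite ll -(eqP (h2 _ e'st)) => /perm_inj le.
by move: pe; rewrite le map_f.
Qed.

Lemma coherent_known st len v c u i l : coherent st len -> len < L ->
  (v, c, u) \in st -> l \notin map label st ->
  foldl rho c (rcons u i) \notin map (place rho) st ->
  coherent ((l, c, rcons u i) :: st) len.+1.
Proof.
move=> [ul up sz sb ap] lenL vst lst bst; split=> /=.
- by rewrite ul andbT.
- by rewrite up andbT.
- move=> e; rewrite inE => /predU1P[->|/sz]; last exact: leqW.
  by rewrite /= size_rcons ltnS (sz _ vst).
- by move=> e; rewrite inE => /predU1P[->|/sb//]; apply: (sb _ vst).
- move=> e e'; rewrite !inE => /predU1P[->|est] /predU1P[->|e'st].
  + by left.
  + exact: (ap _ _ vst e'st).
  + exact: (ap _ _ est vst).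
  + exact: ap.
Qed.

Lemma apartC c c' : apart c c' -> apart c' c.
Proof. by move=> h u u' su su'; have [h1 h2] := h u' u su' su; split=> /esym. Qed.

Lemma admissible_place st len c : coherent st len -> len <= L ->
  admissible (map center st) c ->
  (c \notin map (place rho) st) && (c \notin map (place rho') st).
Proof.
move=> [_ _ sz _ _] lenL [_ ap].
apply/andP; split; apply/negP => /mapP[e est ce].
  have [] := ap _ (map_f _ est) [::] e.2 (leq0n _) (leq_trans (sz _ est) lenL).
  by rewrite /= {1}ce.
have [] := ap _ (map_f _ est) [::] e.2 (leq0n _) (leq_trans (sz _ est) lenL).
by rewrite /= {2}ce.
Qed.

Lemma coherent_fresh st len v c : coherent st len -> len <= L ->
  v \notin map label st -> admissible (map center st) c ->
  coherent ((v, c, [::]) :: st) len.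
Proof.
move=> coh lenL vst adm; have /andP[cp _] := admissible_place coh lenL adm.
case: coh => ul up sz sb ap; case: adm => sc ac; split=> /=.
- by rewrite vst.
- by rewrite up andbT.
- by move=> e; rewrite inE => /predU1P[->|/sz].
- by move=> e; rewrite inE => /predU1P[->|/sb].
- move=> e e'; rewrite !inE => /predU1P[->|est] /predU1P[->|e'st].
  + by left.
  + by right; apply/ac/map_f.
  + by right; apply/apartC/ac/map_f.
  + exact: ap.
Qed.

Lemma mul_pred_fact k : (k * (k.-1)`! <= k`!)%N.
Proof. by case: k. Qed.

Lemma card_notin (s : seq 'I_n) : uniq s -> #|[pred x | x \notin s]| = n - size s.
Proof.
move=> us; have := cardC [in s]; rewrite card_ord (card_uniqP us) => e.
by apply: (@addnI (size s)); rewrite subnKC ?e // -(card_uniqP us) -[leqRHS]card_ord max_card.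
Qed.

Let N0 := n - q.*2.

(** Among the permutations compatible with [st], the numbers of accepting ones differ in one
    direction by at most a fraction [kappa / N0] per remaining query. Multiplying by [N0] keeps this
    in the natural numbers. *)
Definition close_counts D st t := (N0 * #|accepting rho st t| <=
  N0 * #|accepting rho' st t| + D * kappa * (n - size st)`!)%N.

Lemma close_counts_known D :
  (forall st len t, coherent st len -> depth_le t D -> len + D <= q ->
     size st + D.*2 <= q.*2 -> close_counts D st t) ->
  forall st len v c u i next, coherent st len -> (v, c, u) \in st ->
    (forall o, depth_le (next o) D) -> len + D < q ->
    size st + D.*2 < q.*2 -> close_counts D st (Query v i next).
Proof.
move=> IH st len v c u i next coh vst dn lenq szq; rewrite /close_counts.
have lenL : len < L by apply: leq_trans qL; lia.
have suL e : e \in st -> size e.2 <= L.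
  by move=> est; have [_ _ sz _ _] := coh; apply: leq_trans (sz _ est) (ltnW lenL).
have cst := map_f center vst; have suiL : size (rcons u i) <= L.
  by rewrite size_rcons; have [_ _ sz _ _] := coh; apply: leq_ltn_trans (sz _ vst) lenL.
have [/mapP[e est eE]|nb] := boolP (foldl rho c (rcons u i) \in map (place rho) st).
  have eE' : place rho' e = foldl rho' c (rcons u i).
    by apply/(same_place coh (map_f _ est) cst (suL _ est) suiL).
  rewrite (card_accepting_known _ vst est (esym eE)).
  rewrite (card_accepting_known _ vst est eE').
  by apply: (IH _ len) => //; lia.
have nb' : foldl rho' c (rcons u i) \notin map (place rho') st.
  apply: contra nb => /mapP[e est eE]; apply/mapP; exists e => //.
  exact/(same_place coh cst (map_f _ est) suiL (suL _ est)).
rewrite !(card_accepting_new _ _ _ vst) // !big_distrr /=.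
(* A label already in use cannot be carried by a new place, so these terms vanish. The [n - size st]
   new labels restore the factorial. *)
rewrite (bigID (fun l => l \in map label st)) /= big1 ?add0n; last first.
  by move=> l lst; rewrite accepting0 ?muln0.
rewrite [X in (_ <= X + _)%N](bigID (fun l => l \in map label st)) /=.
rewrite -addnA; apply: leq_trans (leq_addl _ _).
apply: (@leq_trans (\sum_(l | l \notin map label st)
   (N0 * #|accepting rho' ((l, c, rcons u i) :: st) (next (Some l))| +
    D * kappa * (n - (size st).+1)`!))).
  apply: leq_sum => l lst.
  apply: (IH _ len.+1); [exact: coherent_known vst lst nb|exact: dn|lia|by rewrite /=; lia].
rewrite big_split /= leq_add2l sum_nat_const.
have [ul _ _ _ _] := coh.
rewrite card_notin // size_map mulnCA leq_mul2l subnS mul_pred_fact orbT //.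
Qed.

(** A query at an unknown label first reveals its vertex [c]. Admissible [c] keep the state
    coherent, the others cost [kappa] once. A query adds at most two entries, which explains
    [q.*2]. *)
Lemma close_countsP D st len t : coherent st len -> depth_le t D ->
  len + D <= q -> size st + D.*2 <= q.*2 -> close_counts D st t.
Proof.
elim: D st len t => [|D IHD] st len [b|v i next] coh //= dt lenq szq.
- have [ul up _ _ _] := coh.
  have up' : uniq (map (place rho') st) by apply: uniq_place' coh; lia.
  by rewrite /close_counts !accepting_answer // leq_addr.
- have [ul up _ _ _] := coh.
  have up' : uniq (map (place rho') st) by apply: uniq_place' coh; lia.
  by rewrite /close_counts !accepting_answer // leq_addr.
have lenL : len <= L by lia.
have [/mapP[[[v' c] u] est /= vE]|vst] := boolP (v \in map label st).
  rewrite /label /= in vE; rewrite -{}vE in est.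
  have := close_counts_known IHD i coh est dt; rewrite /close_counts => h.
  apply: leq_trans (h _ _) _; [lia|lia|].
  by rewrite leq_add2l !leq_mul // leqnSn.
rewrite /close_counts !(card_accepting_fresh _ _ _ v) !big_distrr /=.
pose adm c := `[< admissible (map center st) c >].
rewrite (bigID adm) /=.
rewrite [X in (_ <= X + _)%N](bigID adm) /=.
set F := (n - (size st).+1)`!.
have h1 : (\sum_(c | adm c) N0 * #|accepting rho ((v, c, [::]) :: st) (Query v i next)| <=
  \sum_(c | adm c) (N0 * #|accepting rho' ((v, c, [::]) :: st) (Query v i next)|) +
  D * kappa * (n - size st)`!)%N.
  apply: (@leq_trans (\sum_(c | adm c)
     (N0 * #|accepting rho' ((v, c, [::]) :: st) (Query v i next)| + D * kappa * F))).
    apply: leq_sum => c /asboolP ac.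
    have coh' := coherent_fresh coh lenL vst ac.
    by apply: (close_counts_known IHD i coh' (mem_head _ _) dt); rewrite /=; lia.
  rewrite big_split /= leq_add2l sum_nat_const mulnCA leq_mul2l; apply/orP; right.
  apply: leq_trans (mul_pred_fact _); rewrite -subnS leq_mul2r; apply/orP; right.
  have [_ up _ _ _] := coh.
  rewrite -[size st](size_map (place rho)) -card_notin //; apply: subset_leq_card.
  apply/fintype.subsetP => c /asboolP ac; rewrite inE.
  by have /andP[] := admissible_place coh lenL ac.
(* Each inadmissible centre contributes at most the number of compatible permutations, and
   [N0 <= n - size st] since the state has at most [q.*2] entries. *)
have h2 : (\sum_(c | ~~ adm c) N0 * #|accepting rho ((v, c, [::]) :: st) (Query v i next)|
   <= kappa * (n - size st)`!)%N.
  apply: (@leq_trans (\sum_(c | ~~ adm c) N0 * F)).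
    apply: leq_sum => c _; rewrite leq_mul2l; apply/orP; right.
    have [ul up _ _ _] := coh.
    have [cp|cp] := boolP (c \in map (place rho) st).
      by rewrite accepting0'.
    by apply: accepting_le; rewrite /= ?vst ?ul ?up ?andbT.
  rewrite sum_nat_const; apply: leq_mul.
    have := few_inadmissible (C := map center st); rewrite size_map => few.
    have {few} := few _; set k1 := #|_|; set k2 := #|_|.
    have -> : k2 = k1 by apply: eq_card => c; rewrite !inE.
    by apply; lia.
  apply: leq_trans (mul_pred_fact _); rewrite -subnS leq_mul2r; apply/orP; right.
  by rewrite /N0; lia.
rewrite mulSn mulnDl.
move: h1 h2; move: (\sum_(c | adm c) _)%N (\sum_(c | adm c) _)%N => a b.
move: (\sum_(c | ~~ adm c) _)%N (\sum_(c | ~~ adm c) _)%N => a' b'.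
by lia.
Qed.

Theorem coupling t : depth_le t q ->
  (N0 * #|[set p : {perm 'I_n} | accepts (relabelled rho p) t]%SET| <=
   N0 * #|[set p : {perm 'I_n} | accepts (relabelled rho' p) t]%SET| +
   q * kappa * n`!)%N.
Proof.
move=> dt; have coh : coherent [::] 0 by split.
have := close_countsP coh dt (leqnn _) (leqnn _); rewrite /close_counts subn0.
have aE r : #|accepting r [::] t| =
    #|[set p : {perm 'I_n} | accepts (relabelled r p) t]%SET|.
  by apply: eq_card => p; rewrite !inE.
by rewrite !aE.
Qed.

End Coupling.

(** * Averaging over the random seed *)

Section Averaging.
Context (R : realType) (disp : measure_display) (T : measurableType disp)
  (P : probability T R) (I : finType).
Local Open Scope ring_scope.

Lemma integral_sum_indic (A : I -> set T) : (forall i, measurable (A i)) ->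
  (\int[P]_w (\sum_(i : I) (\1_(A i) w)%:E) = \sum_(i : I) P (A i))%E.
Proof.
move=> mA; rewrite ge0_integral_sum //.
- by apply: eq_bigr => i _; rewrite integral_indic // setIT.
- by move=> i; apply/measurable_EFinP; apply: measurable_indic.
Qed.

Lemma le_sum_probability (A B : I -> set T) (c : R) : 0 <= c ->
  (forall i, measurable (A i)) -> (forall i, measurable (B i)) ->
  (forall w, \sum_(i : I) \1_(A i) w <= \sum_(i : I) \1_(B i) w + c) ->
  (\sum_(i : I) P (A i) <= \sum_(i : I) P (B i) + c%:E)%E.
Proof.
move=> c0 mA mB AB; rewrite -!integral_sum_indic //.
have mS (D : I -> set T) : (forall i, measurable (D i)) ->
    measurable_fun setT (fun w => (\sum_(i : I) (\1_(D i) w)%:E)%E).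
  move=> mD; apply: emeasurable_sum => i; apply/measurable_EFinP.
  exact: measurable_indic.
have ge0 (D : I -> set T) w : (0 <= \sum_(i : I) (\1_(D i) w : R)%:E)%E.
  by apply: sume_ge0 => i _; rewrite lee_fin.
have -> : c%:E = (\int[P]_w cst c%:E w)%E.
  by rewrite integral_cst // [X in (_ * X)%E]probability_setT mule1.
rewrite -ge0_integralD //; last exact: mS.
apply: ge0_le_integral => //; [exact: mS| |].
  by apply: emeasurable_funD; [exact: mS|exact: measurable_cst].
by move=> w _; rewrite !sumEFin -EFinD lee_fin; apply: AB.
Qed.

End Averaging.

(** * The covering of one level by the next *)

Section Inadmissible.
Variables (n d : nat) (rho rho' : 'I_n -> 'I_d -> 'I_n).
Hypothesis rho_sym : forall x i, exists j, rho (rho x i) j = x.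
Hypothesis rho'_sym : forall x i, exists j, rho' (rho' x i) j = x.
Variables (L : nat).

Lemma foldl_back (r : 'I_n -> 'I_d -> 'I_n) c u :
  (forall x i, exists j, r (r x i) j = x) ->
  exists2 v, size v = size u & foldl r (foldl r c u) v = c.
Proof.
move=> rs; elim/last_ind: u => [|u i [v sv vE]]; first by exists [::].
rewrite foldl_rcons; have [j jE] := rs (foldl r c u) i.
by exists (j :: v); rewrite /= ?sv ?size_rcons // jE.
Qed.

Definition meets (r : 'I_n -> 'I_d -> 'I_n) (c' c : 'I_n) := exists u u',
  [/\ size u <= L, size u' <= L & foldl r c u = foldl r c' u'].

(** Steps can be reversed, so such a [c] is reached from [c'] by a walk of length at most
    [L + L]. *)
Lemma card_meets (r : 'I_n -> 'I_d -> 'I_n) c' :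
  (forall x i, exists j, r (r x i) j = x) ->
  #|[set c | `[< meets r c' c >]]%SET| <= #|{: (L + L).-bseq 'I_d}|.
Proof.
move=> rs; pose f (b : (L + L).-bseq 'I_d) := foldl r c' b.
apply: leq_trans (leq_imset_card f predT); apply: subset_leq_card.
apply/fintype.subsetP => c; rewrite inE => /asboolP[u [u' [su su' e]]].
have [v sv vE] := foldl_back c u rs; apply/imsetP.
exists (insub_bseq (L + L) (u' ++ v)) => //.
rewrite /f /insub_bseq -[bseqval _]/(val _) insubdK; last first.
  by rewrite /in_mem /= size_cat sv leq_add.
by rewrite foldl_cat -e vE.
Qed.

Lemma card_inadmissible q (C : seq 'I_n) : size C <= q ->
  #|[set c | ~~ `[< admissible rho rho' L C c >]]%SET| <=
  #|[set c | ~~ `[< same_ball rho rho' L c >]]%SET| +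
  q * (#|{: (L + L).-bseq 'I_d}| + #|{: (L + L).-bseq 'I_d}|).
Proof.
move=> sC; set m := #|{: _}|; set B := [set c | ~~ `[< same_ball _ _ _ _ >]]%SET.
pose A c' := ([set c | `[< meets rho c' c >]] :|: [set c | `[< meets rho' c' c >]])%SET.
have cA c' : #|A c'| <= m + m.
  apply: leq_trans (leq_card_setU _ _) _.
  by apply: leq_add; apply: card_meets.
apply: (@leq_trans #|(B :|: \bigcup_(c' <- C) A c')%SET|).
  apply: subset_leq_card; apply/fintype.subsetP => c; rewrite !inE.
  apply: contraR; rewrite negb_or negbK => /andP[/asboolP sb nA]; apply/asboolP.
  split=> // c' c'C u u' su su'.
  move: nA; rewrite (big_rem c') //= inE negb_or => /andP[+ _].
  rewrite !inE negb_or => /andP[/asboolPn h1 /asboolPn h2].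
  by split=> e; [apply: h1|apply: h2]; exists u, u'.
apply: leq_trans (leq_card_setU _ _) _; rewrite leq_add2l.
apply: (@leq_trans (size C * (m + m))); last by rewrite leq_mul2r sC orbT.
elim: C {sC} => [|c' C IHC]; first by rewrite big_nil cards0.
rewrite big_cons mulSn; apply: leq_trans (leq_card_setU _ _) _.
exact: leq_add.
Qed.

End Inadmissible.

Definition level_type (k : nat) := (k.-bseq letter * pos)%type.
Definition num_vertices (k : nat) := #|{: level_type k}|.

Section Labels.
Variable k : nat.
Let n := num_vertices k.

Definition vertex_of (u : 'I_n) : vertex :=
  (bseqval (enum_val u).1, (enum_val u).2).
Definition label_of (x : vertex) : 'I_n :=
  enum_rank ((insub_bseq k x.1, x.2) : level_type k).

Lemma vertex_ofK : cancel vertex_of label_of.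
Proof.
move=> u; rewrite /label_of /vertex_of /=.
suff -> : insub_bseq k (bseqval (enum_val u).1) = (enum_val u).1.
  by rewrite -surjective_pairing enum_valK.
by apply: val_inj; rewrite /insub_bseq insubdK // -topredE /= size_bseq.
Qed.

Lemma label_ofK x : size x.1 <= k -> vertex_of (label_of x) = x.
Proof.
move=> sx; rewrite /vertex_of /label_of enum_rankK /=.
rewrite /insub_bseq -[bseqval _]/(val _) insubdK //.
by case: x sx.
Qed.

Lemma size_vertex_of u : size (vertex_of u).1 <= k.
Proof. exact: size_bseq. Qed.

Definition cubic (N : vertex -> seq vertex) := forall x, size x.1 <= k ->
  [/\ size (N x) = 3, uniq (N x), x \notin N x &
      forall y, y \in N x -> size y.1 <= k /\ x \in N y].

Definition vstep (N : vertex -> seq vertex) (x : vertex) (i : 'I_3) :=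
  nth x (N x) i.

Definition rho_of N (u : 'I_n) (i : 'I_3) : 'I_n :=
  label_of (vstep N (vertex_of u) i).

Section OfListing.
Variable N : vertex -> seq vertex.
Hypothesis cubN : cubic N.

Lemma mem_vstep x i : size x.1 <= k -> vstep N x i \in N x.
Proof. by move=> /cubN[s3 _ _ _]; apply: mem_nth; rewrite s3. Qed.

Lemma vertex_of_rho u i : vertex_of (rho_of N u i) = vstep N (vertex_of u) i.
Proof.
rewrite label_ofK //; have su := size_vertex_of u.
by have [_ _ _ /(_ _ (mem_vstep i su))[]] := cubN su.
Qed.

Lemma mem_listing x y : size x.1 <= k -> y \in N x -> exists i, vstep N x i = y.
Proof.
move=> /cubN[s3 _ _ _] yx.
have i3 : index y (N x) < 3 by move: (yx); rewrite -index_mem s3.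
by exists (Ordinal i3); rewrite /vstep nth_index.
Qed.

Lemma rho_of_sym u i : exists j, rho_of N (rho_of N u i) j = u.
Proof.
have su := size_vertex_of u.
have [_ _ _ /(_ _ (mem_vstep i su))[sy xy]] := cubN su.
have [j jE] := mem_listing sy xy; exists j.
by rewrite -[RHS]vertex_ofK -jE -vertex_of_rho /rho_of.
Qed.

Lemma vertex_of_walk c u :
  vertex_of (foldl (rho_of N) c u) = foldl (vstep N) (vertex_of c) u.
Proof. by elim: u c => //= i u IHu c; rewrite IHu vertex_of_rho. Qed.

Lemma exists_graph (p : {perm 'I_n}) : exists G : graph n,
  [/\ forall u v, G u v = (vertex_of (p v) \in N (vertex_of (p u))),
      bounded_degree 3 G & oracle_of G (relabelled (rho_of N) p)].
Proof.
pose adj (u v : 'I_n) := vertex_of (p v) \in N (vertex_of (p u)).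
have asym : symmetric adj.
  move=> u v; apply/idP/idP => h.
    by have [_ _ _ /(_ _ h)[]] := cubN (size_vertex_of (p u)).
  by have [_ _ _ /(_ _ h)[]] := cubN (size_vertex_of (p v)).
have airr : irreflexive adj.
  by move=> u; apply/negbTE; have [] := cubN (size_vertex_of (p u)).
pose l u := [seq (p^-1)%g (label_of y) | y <- N (vertex_of (p u))].
have ml u v : (v \in l u) = adj u v.
  apply/mapP/idP => [[y yu ->]|h].
    rewrite /adj permKV label_ofK //.
    by have [_ _ _ /(_ _ yu)[]] := cubN (size_vertex_of (p u)).
  by exists (vertex_of (p v)) => //; rewrite vertex_ofK permK.
have ul u : uniq (l u).
  have [_ un _ sz] := cubN (size_vertex_of (p u)).
  rewrite map_inj_in_uniq // => x y /sz[sx _] /sz[sy _] /perm_inj e.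
  by rewrite -(label_ofK sx) e label_ofK.
have sl u : size (l u) = 3.
  by rewrite size_map; have [] := cubN (size_vertex_of (p u)).
exists (Graph asym airr); split=> // [u|u].
  rewrite /degree -[leqRHS](sl u) -(card_uniqP (ul u)); apply: subset_leq_card.
  by apply/fintype.subsetP => v; rewrite inE ml.
exists (l u); split=> // i; rewrite /relabelled /rho_of /vstep.
have ns : i < size (N (vertex_of (p u))) by rewrite -(size_map (fun y => (p^-1)%g (label_of y))) sl.
rewrite onthE (nth_map ((p^-1)%g (label_of (vertex_of (p u))))) ?sl //.
by rewrite (nth_map (vertex_of (p u))).
Qed.

End OfListing.
End Labels.

Lemma cubic_nbrs k : cubic k (nbrs k).
Proof.
move=> x sx; split=> [||| y yx].
- exact: size_nbrs.
- exact: nbrs_uniq.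
- exact: nbrs_irr.
- by split; [apply: size_of_nbrs sx yx|apply: nbrs_sym sx yx].
Qed.

(* Four disjoint copies of the level-[k] graph, indexed by the last letter of
   the words, and one copy of the level-0 graph. *)
Definition split_nbrs k (x : vertex) : seq vertex :=
  if x.1 is l :: v then
    [seq (rcons y.1 (last l v), y.2) | y <- nbrs k (belast l v, x.2)]
  else nbrs 0 x.

Lemma split_nbrs_rcons k w f s : split_nbrs k (rcons w f, s) =
  [seq (rcons y.1 f, y.2) | y <- nbrs k (w, s)].
Proof. by case: w => [|l w] //=; rewrite /split_nbrs /= last_rcons belast_rcons. Qed.

Lemma cubic_split_nbrs k : cubic k.+1 (split_nbrs k).
Proof.
move=> [w s]; case: (lastP w) => {w} [_|w f] /=.
  have [s3 un irr sy] := cubic_nbrs (leqnn 0 : size ([::], s).1 <= 0).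
  split=> // -[v t] /sy[/=]; rewrite leqn0 size_eq0 => /eqP -> h.
  by split.
rewrite size_rcons ltnS => sw.
have [s3 un irr sy] := cubic_nbrs (sw : size (w, s).1 <= k).
have ri : injective (fun y : vertex => (rcons y.1 f, y.2)).
  move=> [a b] [c e] h; have /rcons_inj[->] := congr1 fst h.
  by have /= -> := congr1 snd h.
rewrite split_nbrs_rcons; split=> [|||y /mapP[z zx ->]].
- by rewrite size_map.
- by rewrite map_inj_uniq.
- apply/negP => /mapP[z zx h]; have /rcons_inj[wz] := congr1 fst h.
  have /= sz := congr1 snd h; move: zx irr.
  by rewrite [z]surjective_pairing -wz -sz => ->.
- have [sz xz] := sy _ zx; rewrite /= size_rcons ltnS; split=> //.
  case: z zx sz xz => z t /= zx sz xz; rewrite split_nbrs_rcons.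
  by apply/mapP; exists (w, s).
Qed.

Lemma flip_rcons w f : w != [::] -> flip (rcons w f) = rcons (flip w) f.
Proof. by case: w. Qed.

Lemma twist_rcons w f : exists f', twist (rcons w f) = rcons (twist w) f'.
Proof.
elim: w => [|l w [f' IHw]] /=; first by exists (opp f); case: ifP.
rewrite IHw; case: ifP => _; first by exists f'.
case: (eqVneq w [::]) => [->|nw] /=; first by exists (opp f').
exists f'; rewrite flip_rcons //.
by rewrite -size_eq0 size_twist size_eq0.
Qed.

(** The maps act on a word with each letter depending only on earlier ones, so dropping the last
    letter commutes with them. The empty word is excluded because there the root joins [Tw] to
    [Par]. *)
Lemma mu_rcons k w f d : w != [::] -> exists f',
  mu k.+1 (rcons w f, d) = (rcons (mu k (w, d)).1 f', (mu k (w, d)).2).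
Proof.
case: w => // l w _; case: d => [[[] []]|l'].
- by exists f.
- have [f' e] := twist_rcons (l :: w) f; exists f'.
  by rewrite -[mu _ _]/(twist (rcons (l :: w) f), Tw) e.
- by exists (rot3i f); rewrite /= map_rcons.
- by exists (rot3 f); rewrite /= map_rcons.
- exists f; rewrite /= size_rcons ltnS; case: ifP => //.
Qed.

Lemma size_mu_pred k x : size x.1 <= (size (mu k x).1).+1.
Proof.
case: x => w [[[] []]|l] /=; rewrite ?size_map ?leqnSn //.
- by case: w.
- by case: w => //= l u; case: ifP => _; rewrite ?size_flip size_twist.
- by case: ifP => _ /=; lia.
Qed.

Lemma vstep_cover k w f s i : w != [::] -> exists f',
  vstep (nbrs k.+1) (rcons w f, s) i =
  (rcons (vstep (nbrs k) (w, s) i).1 f', (vstep (nbrs k) (w, s) i).2).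
Proof.
move=> nw; rewrite /vstep /nbrs /= !nth_cat !size_map.
have i3 := ltn_ord i; have sn := size_nb s.
case: ltnP => [i_s|i_s]; first by exists f; rewrite !(nth_map 0).
case: ifP sn => [s20|_] sn; last by move: i_s; rewrite sn leqNgt i3.
have -> : i - size (nb s) = 0 by move: i_s; rewrite sn; lia.
have [f' e] := mu_rcons k f (port s) nw; exists f'.
suff E : ext k.+1 (rcons w f, s) = (rcons (ext k (w, s)).1 f', (ext k (w, s)).2).
  exact: E.
by rewrite /ext [mu k.+1 _]e.
Qed.

Lemma size_vstep_pred k x i : size x.1 <= (size (vstep (nbrs k) x i).1).+1.
Proof.
rewrite /vstep /nbrs nth_cat size_map; case: ltnP => [i_s|i_s].
  by rewrite (nth_map 0) /=.
case: ifP => _; last by rewrite nth_default.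
case: (_ - _)%N => [|j] /=; last by rewrite nth_default.
exact: (size_mu_pred k (x.1, port x.2)).
Qed.

(** A step shortens the word by at most one, so a walk no longer than [w] does not step out of the
    root before it ends. *)
Lemma walk_cover k w f s u : size u <= size w -> exists f',
  foldl (vstep (nbrs k.+1)) (rcons w f, s) u =
  (rcons (foldl (vstep (nbrs k)) (w, s) u).1 f',
   (foldl (vstep (nbrs k)) (w, s) u).2).
Proof.
elim: u w f s => [|i u IHu] w f s /= su; first by exists f.
have nw : w != [::] by case: w su.
have [f' ->] := vstep_cover k f s i nw.
have := size_vstep_pred k (w, s) i; case: (vstep _ _ _) => w' s' /= sw.
by apply: IHu; lia.
Qed.

Lemma walk_split k w f s u :
  foldl (vstep (split_nbrs k)) (rcons w f, s) u =
  (rcons (foldl (vstep (nbrs k)) (w, s) u).1 f,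
   (foldl (vstep (nbrs k)) (w, s) u).2).
Proof.
elim: u w s => //= i u IHu w s.
have -> : vstep (split_nbrs k) (rcons w f, s) i =
   (rcons (vstep (nbrs k) (w, s) i).1 f, (vstep (nbrs k) (w, s) i).2).
  by rewrite /vstep split_nbrs_rcons (nth_map (w, s)) // size_nbrs.
by case: (vstep _ _ _) => w' s' /=.
Qed.

Lemma num_verticesE k : num_vertices k = (\sum_(i < k.+1) 4 ^ i * 28)%N.
Proof.
rewrite /num_vertices card_prod card_ord card_bseq big_distrl /=.
by apply: eq_bigr => i _; rewrite card_prod card_bool.
Qed.

Lemma num_verticesS k : num_vertices k.+1 = (4 * num_vertices k + 28)%N.
Proof.
rewrite !num_verticesE big_ord_recl /= addnC big_distrr /=; congr (_ + _)%N.
by apply: eq_bigr => i _; rewrite /bump /= add1n expnS mulnA.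
Qed.

Lemma num_vertices_ge k : 4 ^ k <= num_vertices k.
Proof.
rewrite num_verticesE big_ord_recr /=; apply: leq_trans (leq_addl _ _).
by rewrite leq_pmulr.
Qed.

Definition wtrunc (w : word) := if w is l :: v then belast l v else [::].
Definition wlast (w : word) := last (false, false) w.

Lemma rcons_wtrunc w : w != [::] -> rcons (wtrunc w) (wlast w) = w.
Proof. by case: w => // l v _; rewrite /wlast /= -lastI. Qed.

(** * Counting vertices whose ball changes under the covering *)

Section BadCount.
Variable L : nat.

Definition returns k (u u' : seq 'I_3) : {set 'I_(num_vertices k)} :=
  [set c | foldl (vstep (nbrs k)) (vertex_of c) u ==
           foldl (vstep (nbrs k)) (vertex_of c) u']%SET.

Definition word_pair := (L.-bseq 'I_3 * L.-bseq 'I_3)%type.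

Definition return_count k := (\sum_(b : word_pair) #|returns k b.1 b.2|)%N.

Definition bad k : {set 'I_(num_vertices k.+1)} :=
  [set c | ~~ `[< same_ball (rho_of (nbrs k.+1)) (rho_of (split_nbrs k)) L c >]]%SET.

Definition top k : {set 'I_(num_vertices k)} :=
  [set c | size (vertex_of c).1 <= L]%SET.

Lemma card_top k : #|top k| <= num_vertices L.
Proof.
pose f c := label_of L (vertex_of (c : 'I_(num_vertices k))).
have fi : {in top k &, injective f}.
  move=> c c'; rewrite !inE => sc sc' e.
  by rewrite -[c]vertex_ofK -(label_ofK sc) -/(f c) e label_ofK // vertex_ofK.
by rewrite -(card_in_imset fi) -[leqRHS]card_ord max_card.
Qed.

Section Level.
Variable k : nat.

Definition split_returns (u u' : seq 'I_3) : {set 'I_(num_vertices k.+1)} :=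
  [set c | foldl (vstep (split_nbrs k)) (vertex_of c) u ==
           foldl (vstep (split_nbrs k)) (vertex_of c) u']%SET.

Definition nonroot : {set 'I_(num_vertices k.+1)} :=
  [set c | (vertex_of c).1 != [::]]%SET.

Lemma vertex_nonroot c : c \in nonroot -> exists w f s,
  [/\ vertex_of c = (rcons w f, s), wtrunc (vertex_of c).1 = w & size w <= k].
Proof.
rewrite inE => nr; exists (wtrunc (vertex_of c).1), (wlast (vertex_of c).1).
exists (vertex_of c).2; split=> //; first by rewrite rcons_wtrunc // -surjective_pairing.
by have := size_vertex_of c; rewrite -{1}(rcons_wtrunc nr) size_rcons.
Qed.

Lemma split_returnsE c u u' w f s : vertex_of c = (rcons w f, s) ->
  (c \in split_returns u u') = (foldl (vstep (nbrs k)) (w, s) u ==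
    foldl (vstep (nbrs k)) (w, s) u').
Proof.
move=> e; rewrite inE e !walk_split.
move: (foldl _ _ u) (foldl _ _ u') => [a b] [a' b'] /=.
by rewrite !xpair_eqE eqseq_rcons eqxx andbT.
Qed.

(** Away from the root, walks meeting at level [k.+1] also meet after the last letter is dropped,
    hence in the copies. *)
Lemma returns_split c u u' : size u <= L -> size u' <= L ->
  c \notin top k.+1 -> c \in returns k.+1 u u' -> c \in split_returns u u'.
Proof.
move=> su su'; rewrite inE -ltnNge => sc.
have nr : c \in nonroot by rewrite inE; apply: contraTneq sc => ->.
have [w [f [s [e _ _]]]] := vertex_nonroot nr.
rewrite (split_returnsE _ _ e) inE e.
have sw : L <= size w by move: sc; rewrite e /= size_rcons.
have [f1 ->] := walk_cover k f s (leq_trans su sw).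
have [f2 ->] := walk_cover k f s (leq_trans su' sw).
move: (foldl _ _ u) (foldl _ _ u') => [a b] [a' b'] /=.
by rewrite !xpair_eqE eqseq_rcons => /andP[/andP[-> _] ->].
Qed.

Lemma card_split_returns u u' :
  #|(nonroot :&: split_returns u u')%SET| <= 4 * #|returns k u u'|.
Proof.
pose f (c : 'I_(num_vertices k.+1)) := (wlast (vertex_of c).1,
  label_of k (wtrunc (vertex_of c).1, (vertex_of c).2)).
have fi : {in (nonroot :&: split_returns u u')%SET &, injective f}.
  move=> c c' /setIP[nc _] /setIP[nc' _] [e1].
  have [w [g [s [e wE sw]]]] := vertex_nonroot nc.
  have [w' [g' [s' [e' wE' sw']]]] := vertex_nonroot nc'.
  move/(congr1 (@vertex_of k)); rewrite !label_ofK ?wE ?wE' // => E.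
  have ew : w = w' := congr1 fst E.
  have es : (vertex_of c).2 = (vertex_of c').2 := congr1 snd E.
  rewrite -[c]vertex_ofK -[c']vertex_ofK; congr label_of.
  rewrite [vertex_of c]surjective_pairing [vertex_of c']surjective_pairing es.
  congr pair; move: nc nc'; rewrite !inE => nc nc'.
  by rewrite -(rcons_wtrunc nc) -(rcons_wtrunc nc') wE wE' ew e1.
rewrite -(card_in_imset fi).
have -> : 4 = #|[set: letter]| by rewrite cardsT card_prod card_bool.
rewrite -cardsX; apply: subset_leq_card; apply/fintype.subsetP => y.
case/imsetP=> c /setIP[nc sc] ->.
have [w [g [s [e wE sw]]]] := vertex_nonroot nc.
have es : (vertex_of c).2 = s by rewrite e.
apply/finset.setXP; split; first by rewrite inE.
by rewrite inE /f wE es label_ofK // -(split_returnsE _ _ e).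
Qed.

Definition false_returns u u' :=
  ((split_returns u u' :\: returns k.+1 u u') :\: top k.+1)%SET.

Lemma card_false_returns u u' : size u <= L -> size u' <= L ->
  #|false_returns u u'| + #|returns k.+1 u u'| <=
  4 * #|returns k u u'| + num_vertices L.
Proof.
move=> su su'.
apply: (@leq_trans (#|false_returns u u'| +
    #|(returns k.+1 u u' :\: top k.+1)%SET| + #|top k.+1|)).
  rewrite -addnA leq_add2l -(cardsID (top k.+1) (returns k.+1 u u')) addnC.
  by rewrite leq_add2l subset_leq_card // finset.subsetIr.
apply: leq_add (card_top _); apply: leq_trans (card_split_returns _ _).
have d0 : (false_returns u u' :&: (returns k.+1 u u' :\: top k.+1))%SET = finset.set0.
  apply/setP => c; rewrite finset.in_setI !finset.in_setD finset.in_set0.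
  by case: (c \in returns _ _ _); rewrite /= ?andbF.
rewrite -cardsUI d0 cards0 addn0.
apply: subset_leq_card; apply/fintype.subsetP => c; rewrite finset.in_setI finset.in_setU.
have nrt : c \notin top k.+1 -> c \in nonroot.
  by rewrite !inE; apply: contra => /eqP ->.
move=> /orP[]; rewrite finset.in_setD => /andP[ct].
  by rewrite finset.in_setD nrt // => /andP[_ ->].
by move=> /(returns_split su su' ct) ->; rewrite nrt.
Qed.

Lemma card_bad : #|bad k| + return_count k.+1 <=
  4 * return_count k + (#|{: word_pair}|.+1) * num_vertices L.
Proof.
have hb : #|bad k| <= num_vertices L +
    \sum_(b : word_pair) #|false_returns b.1 b.2|.
  apply: (@leq_trans #|(top k.+1 :|: \bigcup_(b : word_pair) false_returns b.1 b.2)%SET|).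
    apply: subset_leq_card; apply/fintype.subsetP => c; rewrite finset.in_setU.
    rewrite inE; apply: contraR; rewrite negb_or => /andP[ct nf].
    apply/asboolP => u u' su su'.
    have cN := @cubic_nbrs k.+1; have cS := @cubic_split_nbrs k.
    have eE r : cubic k.+1 r -> (foldl (rho_of r) c u = foldl (rho_of r) c u') <->
        (foldl (vstep r) (vertex_of c) u == foldl (vstep r) (vertex_of c) u').
      move=> cr; rewrite -!(vertex_of_walk cr); split=> [->//|/eqP].
      exact: (can_inj (@vertex_ofK _)).
    rewrite (eE _ cN) (eE _ cS); split=> h.
      by have := returns_split su su' ct; rewrite !inE; apply.
    apply: contraNT nf => h'.
    have iE z : size z <= L -> insub_bseq L z = z :> seq 'I_3.
      by move=> sz; rewrite /insub_bseq -[bseqval _]/(val _) insubdK.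
    apply/bigcupP; exists (insub_bseq L u, insub_bseq L u') => //=.
    by rewrite !iE // finset.in_setD ct finset.in_setD !inE h' h.
  apply: leq_trans (leq_card_setU _ _) _; apply: leq_add (card_top _) _.
  elim/big_ind2: _ => [|A a B b ha hb|//]; first by rewrite cards0.
  by apply: leq_trans (leq_card_setU _ _) _; apply: leq_add.
have h : (\sum_(b : word_pair) (#|false_returns b.1 b.2| + #|returns k.+1 b.1 b.2|) <=
    \sum_(b : word_pair) (4 * #|returns k b.1 b.2| + num_vertices L))%N.
  by apply: leq_sum => b _; apply: card_false_returns; apply: size_bseq.
have e4 : (4 * return_count k = \sum_(b : word_pair) 4 * #|returns k b.1 b.2|)%N.
  by rewrite /return_count big_distrr.
have sc : (\sum_(b : word_pair) num_vertices L = #|{: word_pair}| * num_vertices L)%N.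
  by rewrite sum_nat_const.
move: h; rewrite big_split [X in (_ <= X)%N]big_split /= sc -e4.
rewrite -/(return_count k.+1) mulSn => h.
rewrite addnCA; apply: leq_trans (leq_add hb (leqnn _)) _.
by rewrite -addnA leq_add2l.
Qed.

End Level.

(* The normalised return counts decrease with the level up to a summable error,
   so the difference of consecutive ones is small at arbitrarily high levels. *)
Lemma few_bad m k0 : exists2 k, k0 <= k & m * #|bad k| <= num_vertices k.+1.
Proof.
apply: contrapT => no.
have hno k : k0 <= k -> num_vertices k.+1 < m * #|bad k|.
  by move=> kk; rewrite ltnNge; apply/negP => h; apply: no; exists k.
set c := (m * (#|{: word_pair}|.+1 * num_vertices L))%N.
have rec k : k0 <= k ->
    (m * return_count k.+1 + 4 ^ k.+1 <= 4 * (m * return_count k) + c)%N.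
  move=> kk; have := hno k kk; have := card_bad k; have := num_vertices_ge k.+1.
  move=> h1 h2 h3.
  have : (m * #|bad k| + m * return_count k.+1 <= 4 * (m * return_count k) + c)%N.
    by rewrite mulnCA /c -!mulnDr leq_mul2l h2 orbT.
  move: (m * return_count k.+1)%N (m * return_count k)%N (m * #|bad k|)%N h3 => x y z h3.
  by move: (4 ^ k.+1)%N (num_vertices k.+1) h1 h3 => a b; clear; lia.
have main j : (m * return_count (k0 + j) + c + j * 4 ^ (k0 + j) <=
    4 ^ j * (m * return_count k0 + c))%N.
  elim: j => [|j IHj]; first by rewrite addn0; lia.
  have := rec (k0 + j) (leq_addr _ _); rewrite addnS [4 ^ j.+1]expnS.
  have : (4 * (m * return_count (k0 + j) + c + j * 4 ^ (k0 + j)) <=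
    4 * (4 ^ j * (m * return_count k0 + c)))%N by rewrite leq_mul2l IHj orbT.
  rewrite expnS -mulnA; move: (4 ^ (k0 + j)) => x.
  by nia.
have := main (m * return_count k0 + c).+1.
set b := (m * return_count k0 + c)%N.
have h : (4 ^ b.+1 <= 4 ^ (k0 + b.+1))%N by rewrite leq_exp2l // leq_addl.
have p : (0 < 4 ^ b.+1)%N by rewrite expn_gt0.
rewrite mulSn; move: (4 ^ b.+1)%N (4 ^ (k0 + b.+1))%N h p => x y h p.
by nia.
Qed.

End BadCount.

(** * Cuts *)

Definition letters : seq letter :=
  [:: (false, false); (true, false); (false, true); (true, true)].

Fixpoint words_of_size (k : nat) : seq word :=
  if k is k'.+1 then [seq l :: u | l <- letters, u <- words_of_size k']
  else [:: [::]].

Lemma mem_words_of_size k w : (w \in words_of_size k) = (size w == k).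
Proof.
elim: k w => [|k IHk] w; first by case: w.
apply/allpairsP/idP => [[[l u] [_ /= uk ->]]|].
  by rewrite /= eqSS -IHk.
case: w => // l u; rewrite /= eqSS -IHk => uk.
by exists (l, u); split=> //; case: l => [[] []].
Qed.

Lemma words_of_size_uniq k : uniq (words_of_size k).
Proof.
by elim: k => // k IHk; apply: allpairs_uniq => // -[l u] [l' u'] _ _ [-> ->].
Qed.

Lemma sumw_words (F : realFieldType) k (f : word -> F) :
  sumw k f = (\sum_(u <- words_of_size k) f u)%R.
Proof.
elim: k f => [|k IHk] f; first by rewrite /= big_seq1.
by rewrite /= !big_cat !big_map /= big_nil addr0 /sum_letter !IHk !addrA.
Qed.

Lemma sumw_count (F : realFieldType) k (P : pred word) :
  sumw k (fun u => (P u)%:R : F)%R =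
  (#|[set w : k.-bseq letter | (size w == k) && P w]%SET|%:R)%R.
Proof.
rewrite sumw_words -natr_sum; congr (_%:R)%R.
rewrite -big_mkcond /= sum1_count -size_filter.
set A := [set w | _]%SET.
rewrite cardE -(size_map (@bseqval k letter)); apply: perm_size; apply: uniq_perm.
- by rewrite filter_uniq // words_of_size_uniq.
- by rewrite map_inj_uniq ?enum_uniq //; apply: val_inj.
move=> w; rewrite mem_filter mem_words_of_size; apply/idP/mapP => [/andP[Pw sw]|].
  have wk : size w <= k by rewrite (eqP sw).
  by exists (Bseq wk) => //; rewrite mem_enum inE /= sw.
by move=> [b]; rewrite mem_enum inE => /andP[sb Pb] ->; rewrite sb Pb.
Qed.

Lemma sumw_const (F : realFieldType) k (c : F) :
  sumw k (fun=> c) = (4 ^+ k * c)%R.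
Proof.
elim: k => [|k IHk]; first by rewrite /= mul1r.
by rewrite /= /sum_letter IHk exprS; ring.
Qed.

Lemma card_bottom k : #|[set w : k.-bseq letter | size w == k]%SET| = 4 ^ k.
Proof.
have := sumw_count rat k predT; rewrite sumw_const mulr1 -natrX => /eqP.
rewrite eqr_nat => /eqP ->; apply: eq_card => w; by rewrite !inE andbT.
Qed.

(** [G] and [M - G] are both at least [N - b]. If [b] were small, their product would be of order
    [N * M]. *)
Lemma cut_arith N M G b : M = (3 * N + 1)%N -> N <= G + b -> G <= 2 * N + b ->
  G <= M -> (G * (M - G) <= 1800 * b * M)%N -> (N <= 4400 * b)%N.
Proof.
move=> MN g1 g2 GM; rewrite leqNgt => gap; apply/negP => lt.
have [p pE] : exists p, N = (p + b)%N by exists (N - b)%N; lia.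
have [x xE] : exists x, G = (p + x)%N by exists (G - p)%N; lia.
have [y yE] : exists y, (M - G = p + y)%N by exists (M - G - p)%N; lia.
have Mxy : M = (p + p + x + y)%N by lia.
move: gap; rewrite yE xE Mxy.
have e : (x + y = p + 3 * b + 1)%N by lia.
have p1 : (4399 * b + 1 <= p)%N by lia.
move: e p1; clear => e p1; rewrite -leqNgt => gap.
have h1 : (p * (p + (x + y)) <= (p + x) * (p + y))%N.
  by rewrite mulnDr [leqRHS]mulnDl !mulnDr; lia.
have h2 : (1800 * b * (p + p + x + y) <= p * (p + p + x + y))%N.
  by rewrite leq_mul2r; apply/orP; right; lia.
have h3 := leq_trans h1 gap.
have h4 : (p * (p + (x + y)) <= 1800 * b * (2 * p + (x + y)))%N.
  by rewrite (_ : 2 * p + (x + y) = p + p + x + y)%N //; lia.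
have h5 : (1800 * b * (2 * p + (x + y)) <= 1800 * b * (2 * (p + (x + y))))%N.
  by rewrite leq_mul2l; apply/orP; right; lia.
have := leq_trans h4 h5; rewrite mulnA leq_mul2r => /orP[|]; lia.
Qed.

Section Cut.
Variables (k : nat) (U : vertex -> bool).
Let K := k.+1.
Let n := num_vertices K.
Notation wordK := (K.-bseq letter).

Definition cut_darts : {set 'I_n * 'I_3} :=
  [set x | U (vertex_of x.1) && ~~ U (vstep (nbrs K) (vertex_of x.1) x.2)]%SET.

Definition broken (w : word) : bool :=
  [exists s : pos, exists i : 'I_3, U (w, s) != U (vstep (nbrs K) (w, s) i)].

Definition count_words (P : pred word) := #|[set w : wordK | P w]%SET|.

Lemma count_wordsS (P Q : pred word) : (forall w, size w <= K -> P w -> Q w) ->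
  count_words P <= count_words Q.
Proof.
move=> PQ; apply: subset_leq_card; apply/fintype.subsetP => w; rewrite !inE.
by apply: PQ; apply: size_bseq.
Qed.

Lemma count_wordsU (P Q : pred word) :
  count_words (fun w => P w || Q w) <= count_words P + count_words Q.
Proof.
rewrite /count_words; apply: leq_trans (leq_card_setU _ _).
by apply: subset_leq_card; apply/fintype.subsetP => w; rewrite !inE.
Qed.

Lemma count_words_inj (P : pred word) (h : word -> word) : injective h ->
  (forall w, size (h w) = size w) ->
  count_words (fun w => P (h w)) <= count_words P.
Proof.
move=> hi hs; pose f (w : wordK) : wordK := insub_bseq K (h w).
have fE w : f w = h w :> word.
  by rewrite /f /insub_bseq -[bseqval _]/(val _) insubdK // -topredE /= hs size_bseq.
have fi : injective f.
  by move=> w w' /(congr1 (@bseqval _ _)); rewrite !fE => /hi; apply: val_inj.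
rewrite /count_words -(card_imset _ fi); apply: subset_leq_card.
by apply/fintype.subsetP => _ /imsetP[w + ->]; rewrite !inE fE.
Qed.

Lemma count_words_child (P : pred word) :
  count_words (fun w => if w is _ :: v then P v else false) <= 4 * count_words P.
Proof.
pose f (w : wordK) : letter * wordK :=
  (head (false, false) w, insub_bseq K (behead w)).
set A := [set w : wordK | if (w : word) is _ :: v then P v else false]%SET.
have fE (w : wordK) : insub_bseq K (behead w) = behead w :> word.
  rewrite /insub_bseq -[bseqval _]/(val _) insubdK // -topredE /= size_behead.
  exact: leq_trans (leq_pred _) (size_bseq _).
have fi : {in A &, injective f}.
  move=> w w'; rewrite !inE => aw aw' [e1 e2]; apply: val_inj => /=.
  have := congr1 (@bseqval _ _) e2; rewrite !fE.
  by case: (bseqval w) aw e1 => // l v _ /= ->; case: (bseqval w') aw' => //= l' v' _ ->.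
rewrite /count_words -(card_in_imset fi).
have -> : 4 = #|[set: letter]| by rewrite cardsT card_prod card_bool.
rewrite -cardsX; apply: subset_leq_card; apply/fintype.subsetP => y.
case/imsetP=> w; rewrite inE => aw ->; apply/finset.setXP; split; first by rewrite inE.
by rewrite inE /f fE; case: (bseqval w) aw.
Qed.

Lemma broken_le_cut : count_words broken <= 2 * #|cut_darts|.
Proof.
pose src (x : 'I_n * 'I_3) : wordK := insub_bseq K (vertex_of x.1).1.
pose tgt (x : 'I_n * 'I_3) : wordK :=
  insub_bseq K (vstep (nbrs K) (vertex_of x.1) x.2).1.
have iE z : size z <= K -> insub_bseq K z = z :> word.
  by move=> sz; rewrite /insub_bseq -[bseqval _]/(val _) insubdK.
apply: (@leq_trans #|(src @: cut_darts :|: tgt @: cut_darts)%SET|); last first.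
  apply: leq_trans (leq_card_setU _ _) _; rewrite mul2n -addnn.
  by apply: leq_add; apply: leq_imset_card.
apply: subset_leq_card; apply/fintype.subsetP => w; rewrite inE.
case/existsP=> s /existsP[i crossed]; rewrite finset.in_setU.
have sw : size ((w : word), s).1 <= K by apply: size_bseq.
have cub := @cubic_nbrs K.
case Uw : (U (bseqval w, s)) crossed => crossed.
  apply/orP; left; apply/imsetP; exists (label_of K (bseqval w, s), i).
    by rewrite inE /= label_ofK // Uw /= -[~~ _]/(true != _).
  by apply: val_inj; rewrite /= /src iE label_ofK.
apply/orP; right; apply/imsetP.
have yw := mem_vstep cub i sw; set y := vstep _ _ _ in yw crossed.
have [sy wy] : size y.1 <= K /\ (bseqval w, s) \in nbrs K y.
  by have [_ _ _ /(_ _ yw)] := cub _ sw.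
have [j jE] := mem_listing cub sy wy.
exists (label_of K y, j).
  rewrite inE /= label_ofK // jE Uw /=; by case: (U y) crossed.
by apply: val_inj; rewrite /= /tgt iE label_ofK // jE.
Qed.

(** [U] is constant on an unbroken gadget, so a single position represents it. *)
Definition side (w : word) : bool := U (w, port_pos Par).

Lemma unbroken_step w s y : size w <= K -> ~~ broken w -> y \in nbrs K (w, s) ->
  U y = U (w, s).
Proof.
move=> sw nb yx; have [i <-] := mem_listing (@cubic_nbrs K) (sw : size (w, s).1 <= K) yx.
move: nb; rewrite /broken => /existsPn/(_ s)/existsPn/(_ i).
by rewrite negbK => /eqP.
Qed.

Lemma unbroken_side w s : size w <= K -> ~~ broken w -> U (w, s) = side w.
Proof.
move=> sw nb; apply: (gadget_connected (P := fun s => U (w, s) = side w)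
  (s0 := port_pos Par)) => // t t' tt' <-.
by apply: unbroken_step; rewrite // mem_nbrs /internal /= eqxx tt'.
Qed.

Lemma unbroken_ext w d : size w <= K -> ~~ broken w ->
  U ((mu K (w, d)).1, port_pos (mu K (w, d)).2) = side w.
Proof.
move=> sw nb; rewrite -(unbroken_side (port_pos d) sw nb).
apply: unbroken_step => //; rewrite mem_nbrs; apply/orP; right.
by rewrite /external port_pos_ge /ext /= port_posK.
Qed.

(** A changed side forces [w] or its image to be broken, since an unbroken gadget agrees with its
    external neighbours. *)
Lemma count_rot : count_words (fun w => (size w == K) && (side (map rot3 w) != side w))
  <= 2 * count_words broken.
Proof.
rewrite mul2n -addnn.
have hi : injective (map rot3) by apply: inj_map; apply: can_inj rot3K.
have hs w : size (map rot3 w) = size w by rewrite size_map.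
apply: leq_trans (leq_add (leqnn _) (count_words_inj broken hi hs)).
apply: leq_trans (count_wordsU _ _); apply: count_wordsS => w sw.
apply: contraTT; rewrite negb_or => /andP[nb nb']; rewrite negb_and negbK.
apply/orP; right; rewrite -(unbroken_ext Rp sw nb) /=.
by rewrite (unbroken_side _ _ nb') // size_map.
Qed.

Lemma count_twist : count_words (fun w => (size w == K) && (side (twist w) != side w))
  <= 2 * count_words broken.
Proof.
rewrite mul2n -addnn.
apply: leq_trans (leq_add (leqnn _) (count_words_inj broken (can_inj twistK) size_twist)).
apply: leq_trans (count_wordsU _ _); apply: count_wordsS => w sw.
apply: contraTT; rewrite negb_or => /andP[nb nb']; rewrite negb_and negbK.
case: w => [|l w] // in sw nb nb' *; apply/orP; right.
rewrite -(unbroken_ext Tw sw nb) -[mu _ _]/(twist (l :: w), Tw).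
by rewrite [U (_, _)](unbroken_side _ _ nb') // size_twist.
Qed.

Lemma side_child l v : size v < K -> ~~ broken v -> side (l :: v) = side v.
Proof. by move=> sv nb; rewrite -(unbroken_ext (Ch l) (ltnW sv) nb) /= sv. Qed.

(** Children of an unbroken word share its side, so the parent of a word counted here is broken; a
    parent has four children. *)
Lemma count_sibling (h : word -> word) :
  (forall l v, exists l', h (l :: v) = l' :: v) ->
  count_words (fun w => (size w == K) && (side (h w) != side w))
  <= 4 * count_words broken.
Proof.
move=> hE; apply: leq_trans (count_words_child broken); apply: count_wordsS => w sw.
case: w sw => // l v sv /andP[_]; apply: contraNT => nb.
by have [l' ->] := hE l v; rewrite !side_child.
Qed.

Hypothesis half : #|[set c : 'I_n | U (vertex_of c)]%SET| = 2 * num_vertices k.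

Let N := (\sum_(i < k.+1) 4 ^ i)%N.

Lemma card_upper : count_words (fun w => size w != K) = N.
Proof.
have := cardsID [set w : wordK | size w == K]%SET [set: wordK]%SET.
rewrite cardsT card_bseq finset.setTI card_bottom big_ord_recr /= card_prod.
rewrite card_bool addnC => /addIn e; rewrite /N -[RHS]e.
by rewrite /count_words; apply: eq_card => w; rewrite !inE andbT.
Qed.

Lemma card_side_sum : #|[set c : 'I_n | U (vertex_of c)]%SET| =
  (\sum_(w : wordK) \sum_(s : pos) U ((w : word), s))%N.
Proof.
rewrite pair_big /= -big_mkcond /= sum1dep_card.
have vi : injective (@enum_val _ predT : 'I_n -> level_type K) by apply: enum_val_inj.
rewrite -(card_imset _ vi); apply: eq_card => x; rewrite inE.
apply/imsetP/idP => [[c + ->]|Ux]; first by rewrite inE.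
exists (enum_rank x); last by rewrite enum_rankK.
by rewrite inE /vertex_of enum_rankK.
Qed.

(** Replacing [U] by [side] changes the count only in broken gadgets, by at most 28 positions
    each. *)
Lemma side_balance : count_words side <= 2 * N + count_words broken /\
  2 * N <= count_words side + count_words broken.
Proof.
have tot : (\sum_(w : wordK) \sum_(s : pos) U ((w : word), s) = 28 * (2 * N))%N.
  by rewrite -card_side_sum half num_verticesE -big_distrl /= -/N [(N * _)%N]mulnC mulnCA.
have cE (P : pred word) : (28 * count_words P = \sum_(w : wordK) 28 * P w)%N.
  by rewrite -big_distrr /= -big_mkcond /= sum1dep_card.
have uE (w : wordK) : ~~ broken w -> (\sum_(s : pos) U ((w : word), s) = 28 * side w)%N.
  move=> nb; rewrite (eq_bigr (fun=> nat_of_bool (side w))).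
    by rewrite sum_nat_const card_ord.
  by move=> s _; rewrite unbroken_side // size_bseq.
have uL (w : wordK) : (\sum_(s : pos) U ((w : word), s) <= 28)%N.
  rewrite -[leqRHS](card_ord 28) -sum1_card; apply: leq_sum => s _.
  by case: (U _).
split.
  rewrite -(leq_pmul2l (isT : 0 < 28)) mulnDr -tot !cE -big_split /=.
  apply: leq_sum => w _; have [bw|/uE ->] := boolP (broken w); last exact: leq_addr.
  by rewrite muln1 (leq_trans _ (leq_addl _ _)) //; case: (side w).
rewrite -(leq_pmul2l (isT : 0 < 28)) mulnDr -tot !cE -big_split /=.
apply: leq_sum => w _; have [bw|/uE ->] := boolP (broken w); last exact: leq_addr.
by rewrite muln1 (leq_trans (uL w)) // leq_addl.
Qed.

(** With about half of the vertices in [U], neither side is negligible on the bottom level, since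
    the upper levels hold only about a quarter of all words. The spectral gap then forces many
    broken gadgets. *)
Theorem cut_large : (num_vertices K <= 1300 * (1000 * #|cut_darts|))%N.
Proof.
set b := count_words broken.
pose G := count_words (fun w => (size w == K) && side w).
have [sb1 sb2] := side_balance; rewrite -/b in sb1 sb2.
have G1 : G <= count_words side by apply: count_wordsS => w _ /andP[].
have G2 : count_words side <= G + N.
  rewrite -card_upper; apply: leq_trans (count_wordsU _ _).
  by apply: count_wordsS => w _; case: (size w == K) => // ->.
pose M := (4 ^ K)%N.
have MN : M = (3 * N + 1)%N.
  rewrite /M /K /N; elim: (k) => [|j IHj]; first by rewrite big_ord1.
  rewrite big_ord_recr /= expnS; move: (\sum_(i < j.+1) _)%N (4 ^ j.+1)%N IHj.
  by move=> x y; clear; lia.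
(* The density of the side on the bottom level is subtracted to obtain mean zero. *)
pose a : rat := (G%:R / M%:R)%R.
pose f (u : word) : rat := ((side u)%:R - a)%R.
have M0 : (0 < M%:R :> rat)%R by rewrite ltr0n expn_gt0.
have sG : sumw K (fun u => (side u)%:R : rat)%R = G%:R%R.
  by rewrite sumw_count.
have MX : (4 ^+ K = M%:R :> rat)%R by rewrite natrX.
have f0 : (sumw K f = 0)%R.
  rewrite /f (sumwD K (fun u => (side u)%:R%R) (fun=> - a)%R) sG sumw_const MX /a.
  by field; rewrite gt_eqF.
have enE h : energy K f h =
    (count_words (fun w => (size w == K) && (side (h w) != side w)))%:R%R.
  rewrite -(sumw_count rat K (fun w => side (h w) != side w)).
  apply: eq_sumw => u _; rewrite /f.
  by case: (side (h u)); case: (side u) => /=; ring.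
have gap := spectral_gap f0; rewrite !enE in gap.
have sf2 : (sumw K (fun u => f u ^+ 2) = G%:R * (M%:R - G%:R) / M%:R)%R.
  transitivity (sumw K (fun u => (1 - 2 * a) * (side u)%:R + a ^+ 2))%R.
    by apply: eq_sumw => u _; rewrite /f; case: (side u) => /=; ring.
  rewrite (sumwD K (fun u => (1 - 2 * a) * (side u)%:R)%R (fun=> a ^+ 2)%R).
  rewrite sumwZ sG sumw_const MX /a; field; by rewrite gt_eqF.
have e1 := count_rot; have e2 := count_twist.
have e3 : count_words (fun w => (size w == K) && (side (flip w) != side w)) <= 4 * b.
  by apply: count_sibling => l v; exists (opp l).
have e4 : count_words (fun w => (size w == K) && (side (flip2 w) != side w)) <= 4 * b.
  by apply: count_sibling => l v; exists (l.1, ~~ l.2).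
rewrite -/b in e1 e2.
move: gap; rewrite sf2 ler_pdivrMr // -!natrD.
set s4 := (X in (_ <= 150 * X%:R * _)%R).
(* The rotation and the twist contribute [2 * b] each, the two sibling flips [4 * b] each; 150 times
   12 gives the constant 1800. *)
have s4b : s4 <= 12 * b by rewrite /s4; lia.
have MG : G <= M.
  rewrite /M -card_bottom /G; apply: subset_leq_card; apply/fintype.subsetP => w.
  by rewrite !inE => /andP[].
rewrite -natrB // -!natrM ler_nat => gap.
have gap2 : (G * (M - G) <= 1800 * b * M)%N.
  apply: leq_trans gap _; rewrite leq_mul2r; apply/orP; right; lia.
have Nb : (N <= 4400 * b)%N.
  by apply: (cut_arith MN _ _ MG gap2); lia.
have cb := broken_le_cut; rewrite -/b in cb.
have N1 : 0 < N by rewrite /N big_ord_recl.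
rewrite num_verticesE -big_distrl /= /K big_ord_recr /= -/N -/K -/M.
by clear -MN Nb cb N1; move: M N b #|cut_darts| MN Nb cb N1 => x y z t; lia.
Qed.

End Cut.

(** * The disjoint copies are far from the property *)

Section Far.
Variable k : nat.
Let K := k.+1.
Let n := num_vertices K.

(** The union of two of the four copies, which no edge of the split graph leaves. *)
Definition copy_side (y : vertex) : bool := (y.1 != [::]) && (wlast y.1).1.

Lemma copy_side_split y z : size y.1 <= K -> z \in split_nbrs k y ->
  copy_side z = copy_side y.
Proof.
case: y => w s; case: (lastP w) => {w} [_|w f sy].
  move=> h; have := size_of_nbrs (leqnn 0 : size ([::], s).1 <= 0) h.
  by rewrite leqn0 size_eq0 /copy_side => /eqP ->.
rewrite split_nbrs_rcons => /mapP[y _ ->].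
by rewrite /copy_side /wlast /= !last_rcons -!size_eq0 !size_rcons.
Qed.

Lemma card_copy_side :
  #|[set c : 'I_n | copy_side (vertex_of c)]%SET| = 2 * num_vertices k.
Proof.
pose f (x : bool * 'I_(num_vertices k)) : 'I_n :=
  label_of K (rcons (vertex_of x.2).1 (true, x.1), (vertex_of x.2).2).
have sf (x : bool * 'I_(num_vertices k)) :
    size (rcons (vertex_of x.2).1 (true, x.1), (vertex_of x.2).2).1 <= K.
  by rewrite size_rcons; apply: (size_vertex_of x.2).
have fi : injective f.
  move=> [b c] [b' c'] /(congr1 (@vertex_of K)).
  rewrite /f (label_ofK (sf (b, c))) (label_ofK (sf (b', c'))) => h.
  have /rcons_inj e1 := congr1 fst h.
  have /= -> : b = b' := congr1 (fun z => z.2.2) e1.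
  have E1 : (vertex_of c).1 = (vertex_of c').1 := congr1 fst e1.
  have E2 : (vertex_of c).2 = (vertex_of c').2 := congr1 snd h.
  congr pair; rewrite -[c]vertex_ofK -[c']vertex_ofK; congr label_of.
  rewrite [vertex_of c]surjective_pairing [vertex_of c']surjective_pairing.
  by rewrite E1 E2.
have -> : 2 * num_vertices k = #|{: bool * 'I_(num_vertices k)}|.
  by rewrite card_prod card_bool card_ord.
rewrite -cardsT -(card_imset _ fi); apply: eq_card => c; rewrite inE.
apply/idP/imsetP => [/andP[nr]|[x _ ->]].
  case e : (wlast (vertex_of c).1) => [a b] /= aT.
  have E : vertex_of c = (rcons (wtrunc (vertex_of c).1) (true, b), (vertex_of c).2).
    by rewrite -aT -e rcons_wtrunc // -surjective_pairing.
  have st : size (wtrunc (vertex_of c).1, (vertex_of c).2).1 <= k.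
    by have := size_vertex_of c; rewrite {1}E size_rcons.
  exists (b, label_of k (wtrunc (vertex_of c).1, (vertex_of c).2)) => //.
  by rewrite /f label_ofK // -[LHS]vertex_ofK {1}E.
rewrite /f label_ofK ?sf // /copy_side /wlast last_rcons andbT.
by rewrite -size_eq0 size_rcons.
Qed.

Lemma num_vertices_inj a b : num_vertices a = num_vertices b -> a = b.
Proof.
have mono i j : i < j -> num_vertices i < num_vertices j.
  elim: j => // j IHj; rewrite ltnS leq_eqVlt num_verticesS => /predU1P[->|/IHj];
  by move: (num_vertices _) => x; lia.
by case: (ltngtP a b) => // /mono h e; move: h; rewrite e ltnn.
Qed.

(** [decode] makes [H] a level graph, in which the union of two copies is a balanced set with a
    large cut. All edges of that cut are missing from [G]. *)
Lemma split_far (G H : graph n) (p : {perm 'I_n}) :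
  (forall u v, G u v = (vertex_of (p v) \in split_nbrs k (vertex_of (p u)))) ->
  bounded_degree 3 H -> graph_models H local_sentence ->
  n <= 1300 * (1000 * edit_distance G H).
Proof.
move=> GE dH sH.
have n0 : 0 < n by apply: leq_trans (num_vertices_ge K); rewrite expn_gt0.
have [K' [beta [bi bs bE]]] := decode dH sH (Ordinal n0).
(* The number of vertices determines the level. *)
have KK : K' = K.
  pose f (c : 'I_(num_vertices K')) := beta (vertex_of c).
  have fi : injective f.
    move=> c c' h; apply: (can_inj (@vertex_ofK K')).
    by apply: bi h; apply: size_vertex_of.
  apply: num_vertices_inj; rewrite -/n -[LHS]card_ord -[RHS]card_ord.
  rewrite -cardsT -(card_imset _ fi) -cardsT; apply: eq_card => z; rewrite inE.
  apply/imsetP; have [x sx <-] := bs z.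
  by exists (label_of K' x) => //; rewrite /f label_ofK.
rewrite {}KK in bi bs bE.
pose g (c : 'I_n) := p (beta (vertex_of c)).
have gi : injective g.
  move=> c c' /perm_inj h; apply: (can_inj (@vertex_ofK K)).
  by apply: bi h; apply: size_vertex_of.
pose U x := copy_side (vertex_of (p (beta x))).
have half : #|[set c : 'I_n | U (vertex_of c)]%SET| = 2 * num_vertices k.
  rewrite -card_copy_side -(card_imset _ gi); apply: eq_card => c.
  apply/imsetP/idP => [[c' + ->]|h]; first by rewrite !inE.
  have [g' gK g'K] := injF_bij gi; exists (g' c); last by rewrite g'K.
  by move: h; rewrite !inE -[in X in X -> _](g'K c).
apply: leq_trans (cut_large half) _; rewrite !leq_mul2l /=.
pose e (x : 'I_n * 'I_3) : {set 'I_n} :=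
  [set beta (vertex_of x.1); beta (vstep (nbrs K) (vertex_of x.1) x.2)]%SET.
have cub := @cubic_nbrs K.
have stepP (x : 'I_n * 'I_3) : vstep (nbrs K) (vertex_of x.1) x.2 \in nbrs K (vertex_of x.1).
  exact: (mem_vstep cub x.2 (size_vertex_of x.1)).
have stepS (x : 'I_n * 'I_3) : size (vstep (nbrs K) (vertex_of x.1) x.2).1 <= K.
  exact: (size_of_nbrs (size_vertex_of x.1) (stepP x)).
pose V z := copy_side (vertex_of (p z)).
(* A cut dart points out of [U], so its unoriented edge determines its source and its target. *)
have ei : {in cut_darts k U &, injective e}.
  move=> x x'; rewrite !inE => /andP[u1 u2] /andP[u1' u2'] E.
  have : beta (vertex_of x.1) \in e x' by rewrite -E !inE eqxx.
  rewrite !inE => /orP[/eqP e1|/eqP e1]; last first.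
    by move: u2'; rewrite /U -e1 -/(U (vertex_of x.1)) u1.
  have : beta (vstep (nbrs K) (vertex_of x.1) x.2) \in e x' by rewrite -E !inE eqxx orbT.
  rewrite !inE => /orP[/eqP e2|/eqP e2].
    by move: u2; rewrite /U e2 -/(U (vertex_of x'.1)) u1'.
  have x1 : x.1 = x'.1.
    by apply: (can_inj (@vertex_ofK K)); apply: bi e1; apply: size_vertex_of.
  have /eqP := bi _ _ (stepS x) (stepS x') e2; rewrite x1 /vstep.
  have [s3 un _ _] := cub _ (size_vertex_of x'.1).
  rewrite nth_uniq ?s3 // => /eqP/val_inj x2.
  by rewrite [x]surjective_pairing [x']surjective_pairing x1 x2.
rewrite /edit_distance -(card_in_imset ei).
apply: leq_trans (leq_addl _ _); apply: subset_leq_card.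
apply/fintype.subsetP => _ /imsetP[x xc ->]; rewrite finset.in_setD.
move: xc; rewrite inE => /andP[u1 u2]; apply/andP; split.
  apply/negP => /imsetP[[a b]]; rewrite inE /= GE => ab E.
  have Vab : V b = V a by apply: copy_side_split ab; apply: size_vertex_of.
  have h1 : beta (vertex_of x.1) \in e x by rewrite !inE eqxx.
  have h2 : beta (vstep (nbrs K) (vertex_of x.1) x.2) \in e x.
    by rewrite !inE eqxx orbT.
  have eV z : z \in e x -> V z = V a.
    by rewrite E !inE => /orP[/eqP ->|/eqP ->].
  have Va : V a by rewrite -(eV _ h1).
  by move/negP: u2; apply; rewrite /U -/(V _) (eV _ h2).
apply/imsetP; exists (beta (vertex_of x.1), beta (vstep (nbrs K) (vertex_of x.1) x.2)) => //.
by rewrite inE /=; apply: bE (stepP x); apply: size_vertex_of.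
Qed.

End Far.

(** * Conclusion *)

Section Indistinguishable.
Variables (R : realType) (k q : nat).
Let K := k.+1.
Let n := num_vertices K.
Let rho := rho_of (k := K) (nbrs K).
Let rho' := rho_of (k := K) (split_nbrs k).
Let balls := #|{: (q + q).-bseq 'I_3}|.
Let kappa := (#|bad q k| + q.*2 * (balls + balls))%N.
Hypothesis enough : (3 * (q * kappa) < n - q.*2)%N.

Lemma few_inadmissible (C : seq 'I_n) : size C <= q.*2 ->
  #|[set c | ~~ `[< admissible rho rho' q C c >]]%SET| <= kappa.
Proof.
apply: card_inadmissible.
- exact: rho_of_sym (@cubic_nbrs K).
- exact: rho_of_sym (@cubic_split_nbrs k).
Qed.

Local Open Scope ring_scope.

(** For each seed, [coupling] compares acceptance over all relabellings. After integration the
    averages 2/3 and 1/3 would differ by at most [q * kappa / N0], which [enough] makes less than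
    1/3. *)
Lemma not_tester (A : algorithm R n 3) : query_bound A q ->
  (forall p : {perm 'I_n}, ((2 / 3)%:E <= pr_accept A (relabelled rho p))%E) ->
  (forall p : {perm 'I_n}, ((2 / 3)%:E <= pr_reject A (relabelled rho' p))%E) ->
  False.
Proof.
move=> qA accA rejA.
pose acc r (p : {perm 'I_n}) := [set w | accepts (relabelled r p) (decide (a := A) w)]%classic.
have macc r p : measurable (acc r p) by apply: measurable_decide.
pose N0 := (n - q.*2)%N.
have N00 : 0 < N0%:R :> R by rewrite ltr0n /N0; lia.
pose c : R := (q * kappa * n`!)%N%:R / N0%:R.
have c0 : 0 <= c by rewrite divr_ge0 ?ler0n.
have sumE N w (cN : cubic K N) : \sum_(p : {perm 'I_n}) \1_(acc (rho_of N) p) w =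
    #|[set p : {perm 'I_n} | accepts (relabelled (rho_of N) p)
        (truncate (decide (a := A) w) q)]%SET|%:R :> R.
  rewrite -sum1_card natr_sum [RHS]big_mkcond /=; apply: eq_bigr => p _.
  rewrite indicE; have [G [_ dG oG]] := exists_graph cN p.
  have e : accepts (relabelled (rho_of N) p) (truncate (decide (a := A) w) q) =
      accepts (relabelled (rho_of N) p) (decide (a := A) w).
    by apply: accepts_truncate; apply: qA dG oG.
  have -> : (w \in acc (rho_of N) p) = accepts (relabelled (rho_of N) p) (decide (a := A) w).
    by apply/idP/idP => [/set_mem|h]; [|apply/mem_set].
  by rewrite finset.inE e; case: accepts.
have AB w : \sum_(p : {perm 'I_n}) \1_(acc rho p) w <=
    \sum_(p : {perm 'I_n}) \1_(acc rho' p) w + c.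
  rewrite (sumE _ _ (@cubic_nbrs K)) (sumE _ _ (@cubic_split_nbrs k)).
  have := coupling few_inadmissible (leqnn q)
    (depth_truncate (decide (a := A) w) q).
  rewrite -(ler_nat R) natrD !natrM -/rho -/rho' -/N0 => h.
  rewrite -(ler_pM2l N00) mulrDr /c [N0%:R * (_ / _)]mulrC divfK ?gt_eqF //.
  by rewrite !natrM.
have := le_sum_probability (seed_law A) c0 (macc rho) (macc rho') AB.
have F0 : 0 < n`!%:R :> R by rewrite ltr0n fact_gt0.
have sumc (x : R) : (\sum_(p : {perm 'I_n}) x%:E = (n`!%:R * x)%:E)%E.
  by rewrite sumEFin sumr_const card_Sn mulr_natl.
have lo : ((n`!%:R * (2 / 3))%:E <= \sum_(p : {perm 'I_n}) seed_law A (acc rho p))%E.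
  by rewrite -sumc; apply: lee_sum => p _; apply: accA.
have hi : (\sum_(p : {perm 'I_n}) seed_law A (acc rho' p) <= (n`!%:R * (1 / 3))%:E)%E.
  rewrite -sumc; apply: lee_sum => p _; have := rejA p; rewrite /pr_reject.
  have -> : [set w | ~~ accepts (relabelled rho' p) (decide (a := A) w)]%classic =
      (~` acc rho' p)%classic.
    by apply/seteqP; split=> w /=; rewrite /acc /= => /negP.
  rewrite probability_setC //.
  rewrite -(fineK (fin_num_measure (seed_law A) _ (macc rho' p))) -EFinB !lee_fin.
  by lra.
move=> le; have := le_trans lo (le_trans le (leeD hi (lexx _))).
rewrite -EFinD lee_fin /c natrM mulrAC [_ * n`!%:R]mulrC -mulrDr ler_pM2l //.
have h : (3 * (q * kappa)%N%:R < N0%:R :> R) by rewrite -natrM ltr_nat.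
suff : (q * kappa)%N%:R / N0%:R < 1 / 3 :> R by lra.
by rewrite ltr_pdivrMr //; lra.
Qed.

End Indistinguishable.

Theorem theorem5p1 (R : realType) :
  exists phi : sentence, Pi2 phi /\ ~ testable R (fo_property 3 phi).
Proof.
exists local_sentence; split; first exact: local_sentence_Pi2.
(* [split_far] gives distance at least [n / 1300000], and three times this [eps] is smaller than
   1/1300000. *)
move=> [qf hq]; pose eps : R := ((4000 * 1000)^-1)%R.
have eps01 : (0 < eps < 1)%R.
  rewrite invr_gt0 invf_lt1; last by lra.
  by apply/andP; split; lra.
set q := qf eps in hq *; pose C0 := #|{: (q + q).-bseq 'I_3}|.
(* [Dc] collects the part of the condition [enough] that does not depend on the level. The choices
   below make it less than a quarter of the vertices and [3 * (q * #|bad q k|)] at most 3/8 of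
   them. *)
pose Dc := (12 * (q * q * C0) + q.*2)%N.
have [k k0k kb] := few_bad q (8 * q.+1) (4 * Dc).+1.
have nD : (4 * Dc < num_vertices k.+1)%N.
  apply: leq_trans (num_vertices_ge k.+1); apply: leq_trans (ltnW (ltn_expl k.+1 (isT : 1 < 4))).
  exact: leqW.
have [A tA qA] := hq (num_vertices k.+1) eps eps01.
apply: (@not_tester R k q _ A qA).
- rewrite -/C0; move: kb nD; rewrite /Dc; move: (num_vertices k.+1) #|bad q k| => n B.
  have -> : (8 * q.+1 * B = 8 * (q * B) + 8 * B)%N by lia.
  have -> : (3 * (q * (B + q.*2 * (C0 + C0))) = 3 * (q * B) + 12 * (q * q * C0))%N.
    by rewrite -addnn; lia.
  by move: (q * B)%N (q * q * C0)%N => x y; lia.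
- move=> p; have [G [GE dG oG]] := exists_graph (@cubic_nbrs k.+1) p.
  apply: (tA G _ dG oG).1; split=> //.
  apply: (level_graph_models (k := k.+1) (lam := fun u => vertex_of (p u))) => //.
  + by move=> u v /(can_inj (@vertex_ofK _))/perm_inj.
  + by move=> u; apply: size_vertex_of.
  + by move=> x sx; exists ((p^-1)%g (label_of k.+1 x)); rewrite permKV label_ofK.
- move=> p; have [G [GE dG oG]] := exists_graph (@cubic_split_nbrs k) p.
  apply: (tA G _ dG oG).2 => H [dH sH].
  have := split_far GE dH sH; rewrite -(ler_nat R) !natrM => h.
  have n0 : (0 < (num_vertices k.+1)%:R :> R)%R.
    by rewrite ltr0n (leq_trans _ (num_vertices_ge _)) // expn_gt0.
  rewrite /eps mulrAC -mulrA mulrC ltr_pdivrMr; last by lra.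
  by lra.
Qed.
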